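(* Assume $f_1,\dots,f_m$ are strongly convex ($\mu>0$, $M>0$) and the prox-functions satisfy the quadratic growth condition with constant $\mathcal{C}$. Let $\mathbf{x}^*$ be an optimal solution of (P), and let $\mathbf{y}^*$ be such that $(\mathbf{x}^*,\mathbf{y}^* )$ is a saddle point of (SP). Assume the stochastic oracle is unbiased with variance bounded by $\sigma^2$ (conditions (A1) and (A2) of the context). Let $N\ge2$, $\tilde D>0$, and run the SDCS method with $$\lambda_t=t,\qquad\beta_t^{(k)}=\frac{(t+1)\mu}{2\eta_k\mathcal{C}}+\frac{t-1}{2},\qquad t\ge1,$$ and, for $k=1,\dots,N$, $$\alpha_k=\frac{k}{k+1},\quad\theta_k=k+1,\quad\eta_k=\frac{k\mu}{2\mathcal{C}},\quad\tau_k=\frac{4\|\mathbf{L}\|^2\mathcal{C}}{(k+1)\mu},$$ $$T_k=\left\lceil\sqrt{\frac{m(M^2+\sigma^2)}{\tilde D}}\,\frac{2N\mathcal{C}}{\mu}\max\left\{\sqrt{\frac{m(M^2+\sigma^2)}{\tilde D}}\,\frac{8\mathcal{C}}{\mu},1\right\}\right\rceil.$$ Then $\hat{\mathbf{x}}^N_{\mathrm{avg}}:=\frac{2}{N(N+3)}\sum_{k=1}^N(k+1)\hat{\mathbf{x}}^k$ satisfies $$\mathbb{E}[F(\hat{\mathbf{x}}^N_{\mathrm{avg}})-F(\mathbf{x}^* )]\le\frac{2}{N(N+3)}\left[\frac{\mu}{\mathcal{C}}\mathbf{V}(\mathbf{x}^0,\mathbf{x}^* )+\frac{2\|\mathbf{L}\|^2\mathcal{C}}{\mu}\|\mathbf{y}^0\|^2+\frac{2\mu\tilde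 D}{\mathcal{C}}\right]$$ and $$\mathbb{E}[\|\mathbf{L}\hat{\mathbf{x}}^N_{\mathrm{avg}}\|]\le\frac{8\|\mathbf{L}\|}{N(N+3)}\left[3\sqrt{2\tilde D+\mathbf{V}(\mathbf{x}^0,\mathbf{x}^* )}+\frac{7\|\mathbf{L}\|\mathcal{C}}{\mu}\|\mathbf{y}^*-\mathbf{y}^0\|\right].$$
   Context: Setting. Let $m\ge 2$, $d\ge 1$, and let $\mathcal{G}=([m],\mathcal{E})$ be a connected undirected graph. Put $N_i=\{j:(i,j)\in\mathcal{E}\}\cup\{i\}$. The Laplacian $L\in\mathbb{R}^{m\times m}$ has $L_{ii}=|N_i|-1$, $L_{ij}=-1$ if $i\ne j$ and $(i,j)\in\mathcal{E}$, and $L_{ij}=0$ otherwise; $\mathbf{L}=L\otimes I_d$. For each $i\in[m]$, $X_i\subseteq\mathbb{R}^d$ is closed convex and $\bigcap_i X_i\neq\emptyset$; $\|\cdot\|_{X_i}$ is a norm on $\mathbb{R}^d$, with dual norm $\|\cdot\|_*$; $f_i:X_i\to\mathbb{R}$ is convex, with subgradients $f_i'(y)\in\partial f_i(y)$ satisfying $\frac{\mu}{2}\|x-y\|_{X_i}^2\le f_i(x)-f_i(y)-\langle f_i'(y),x-y\rangle\le M\|x-y\|_{X_i}$ for all $x,y\in X_i$. Prox-functions. $\omega_i:X_i\to\mathbb{R}$ is continuously differentiable with $\langle\nabla\omega_i(x)-\nabla\omega_i(u),x-u\rangle\ge\|x-u\|_{X_i}^2$, and $V_i(x,u)=\omega_i(u)-\omega_i(x)-\langle\nabla\omega_i(x),u-x\rangle$.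 Quadratic growth condition with constant $\mathcal{C}>0$: $V_i(x_i,u_i)\le\frac{\mathcal{C}}{2}\|x_i-u_i\|_{X_i}^2$ for all $x_i,u_i\in X_i$ and all $i$. Write $X^m=X_1\times\dots\times X_m$, $\mathbf{x}=(x_1,\dots,x_m)$, $\|\mathbf{x}\|^2=\sum_i\|x_i\|_{X_i}^2$ for primal vectors, $\mathbf{V}(\mathbf{x},\mathbf{u})=\sum_iV_i(x_i,u_i)$. Dual vectors $\mathbf{y}\in\mathbb{R}^{md}$ and vectors $\mathbf{L}\mathbf{x}$ are measured in the Euclidean norm, and $\|\mathbf{L}\|$ is the operator norm from the primal norm to the Euclidean norm. Problem. (P): minimize $F(\mathbf{x})=\sum_{i=1}^mf_i(x_i)$ subject to $\mathbf{L}\mathbf{x}=\mathbf{0}$, $\mathbf{x}\in X^m$. (SP): $\min_{\mathbf{x}\in X^m}\big[F(\mathbf{x})+\max_{\mathbf{y}\in\mathbb{R}^{md}}\langle\mathbf{L}\mathbf{x},\mathbf{y}\rangle\big]$. It is assumed that there are an optimal solution $\mathbf{x}^*$ of (P) and $\mathbf{y}^*\in\mathbb{R}^{md}$ such that $(\mathbf{x}^*,\mathbf{y}^* )$ is a saddle point of (SP). Stochastic oracle. At a point $u\in X_i$ the oracle for $f_i$ returns $G_i(u,\xi_i)$, where the random vector $\xi_i$ drawn at that call is independent of the search point at which the oracle is called. (A1) $\mathbb{E}[G_i(u,\xi_i)]=f_i'(u)\in\partial f_i(u)$. (A2) $\mathbb{E}[\|G_i(u,\xi_i)-f_i'(u)\|_*^2]\le\sigma^2$.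 SDCS method. Given (deterministic) $\mathbf{x}^0=\mathbf{x}^{-1}=\hat{\mathbf{x}}^0\in X^m$, $\mathbf{y}^0\in\mathbb{R}^{md}$, parameters $\alpha_k,\tau_k,\eta_k$, positive integers $T_k$, and inner parameters $\lambda_t,\beta_t^{(k)}$ (the $\theta_k$ are averaging weights), for $k=1,\dots,N$ set $\tilde{\mathbf{x}}^k=\alpha_k(\hat{\mathbf{x}}^{k-1}-\mathbf{x}^{k-2})+\mathbf{x}^{k-1}$; $\mathbf{y}^k=\mathbf{y}^{k-1}+\frac1{\tau_k}\mathbf{L}\tilde{\mathbf{x}}^k$; $\mathbf{w}^k=(w_1^k,\dots,w_m^k)=\mathbf{L}\mathbf{y}^k$; and for each $i\in[m]$: $u_i^{0,k}=x_i^{k-1}$; for $t=1,\dots,T_k$, $h_i^{t-1,k}=G_i(u_i^{t-1,k},\xi_i^{t-1,k})$ and $u_i^{t,k}=\arg\min_{u\in X_i}\big[\langle w_i^k+h_i^{t-1,k},u\rangle+\eta_kV_i(x_i^{k-1},u)+\eta_k\beta_t^{(k)}V_i(u_i^{t-1,k},u)\big]$; then $x_i^k=u_i^{T_k,k}$ and $\hat x_i^k=\big(\sum_{t=1}^{T_k}\lambda_t\big)^{-1}\sum_{t=1}^{T_k}\lambda_tu_i^{t,k}$. *)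

(* Defs.v *)
From mathcomp Require Import all_boot all_order all_algebra.
From mathcomp Require Import mxtens.
From mathcomp Require Import all_classical all_reals all_analysis.

Set Implicit Arguments.
Unset Strict Implicit.
Unset Printing Implicit Defensive.

Import Order.TTheory GRing.Theory Num.Theory.
Import numFieldNormedType.Exports.

Local Open Scope classical_set_scope.
Local Open Scope ring_scope.

(* Vectors of R^d are rows 'rV[R]_d.  A stacked vector (x_1, .., x_m) of R^{md}
   is the matrix 'M[R]_(m, d) whose i-th row is the block x_i.  A function on a
   subset X of R^d is a total function of which only the values on X matter. *)

Definition inner (R : realType) (p q : nat) (x y : 'M[R]_(p, q)) : R :=
  \sum_i \sum_j x i j * y i j.

Definition enorm (R : realType) (p q : nat) (x : 'M[R]_(p, q)) : R :=
  Num.sqrt (inner x x).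

Definition is_norm (R : realType) (d : nat) (nu : 'rV[R]_d -> R) : Prop :=
  [/\ forall x, nu x = 0 -> x = 0,
      forall a x, nu (a *: x) = `|a| * nu x
    & forall x y, nu (x + y) <= nu x + nu y].

Definition dual_norm (R : realType) (d : nat) (nu : 'rV[R]_d -> R)
    (g : 'rV[R]_d) : R :=
  sup [set inner g x | x in [set x | nu x <= 1]].

Definition subdifferential (R : realType) (d : nat) (X : set 'rV[R]_d)
    (f : 'rV[R]_d -> R) (y : 'rV[R]_d) : set 'rV[R]_d :=
  [set g | forall x, X x -> f y + inner g (x - y) <= f x].

(* f is continuously differentiable on X with gradient gf.  Both the
   differentiability and the continuity are relative to X, which may have an
   empty interior. *)
Definition C1_on (R : realType) (d : nat) (X : set 'rV[R]_d)
    (f : 'rV[R]_d -> R) (gf : 'rV[R]_d -> 'rV[R]_d) : Prop :=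
  {within X, continuous gf} /\
  forall x, X x ->
    (f u - f x - inner (gf x) (u - x)) / `|u - x|
      @[u --> within X x^'] --> (0 : R).

Definition bregman (R : realType) (d : nat) (w : 'rV[R]_d -> R)
    (gw : 'rV[R]_d -> 'rV[R]_d) (x u : 'rV[R]_d) : R :=
  w u - w x - inner (gw x) (u - x).

Definition is_argmin (R : realType) (T : Type) (X : set T) (phi : T -> R)
    (z : T) : Prop :=
  X z /\ forall v, X v -> phi z <= phi v.

Definition closed_nbh (m : nat) (e : rel 'I_m) (i : 'I_m) : {set 'I_m} :=
  [set j | e i j || (j == i)]%SET.

Definition laplacian (R : realType) (m : nat) (e : rel 'I_m) : 'M[R]_m :=
  \matrix_(i, j) (if i == j then #|closed_nbh e i|%:R - 1
                  else if e i j then -1 else 0).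

Definition stack (R : realType) (m d : nat) (x : 'M[R]_(m, d)) :
    'cV[R]_(m * d) :=
  \col_k x (mxtens_unindex k).1 (mxtens_unindex k).2.

Definition unstack (R : realType) (m d : nat) (v : 'cV[R]_(m * d)) :
    'M[R]_(m, d) :=
  \matrix_(i, j) v (mxtens_index (i, j)) 0.

(* The Kronecker product of the Laplacian with I_d, acting on stacked
   vectors. *)
Definition bigL (R : realType) (m d : nat) (e : rel 'I_m) (x : 'M[R]_(m, d)) :
    'M[R]_(m, d) :=
  unstack ((laplacian R e *t 1%:M) *m stack x).

Lemma bigLE (R : realType) (m d : nat) (e : rel 'I_m) (x : 'M[R]_(m, d)) :
  bigL e x = laplacian R e *m x.
Proof.
apply/matrixP => i j; rewrite !mxE.
rewrite (reindex (@mxtens_index m d)) /=; last first.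
  by exists (@mxtens_unindex m d) => p _;
    rewrite (mxtens_indexK, mxtens_unindexK).
transitivity (\sum_k \sum_l
    (laplacian R e *t 1%:M) (mxtens_index (i, j)) (mxtens_index (k, l)) *
    stack x (mxtens_index (k, l)) 0).
  by rewrite pair_bigA; apply: eq_bigr => -[].
apply: eq_bigr => k _; rewrite (bigD1 j) //= big1 ?addr0 => [|l lj].
  by rewrite tensmxE [1%:M _ _]mxE eqxx mulr1 [stack _ _ _]mxE mxtens_indexK.
by rewrite tensmxE [1%:M _ _]mxE eq_sym (negbTE lj) mulr0 mul0r.
Qed.

Definition in_prod (R : realType) (m d : nat) (X : 'I_m -> set 'rV[R]_d)
    (x : 'M[R]_(m, d)) : Prop :=
  forall i, X i (row i x).

Definition total_cost (R : realType) (m d : nat)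
    (f : 'I_m -> 'rV[R]_d -> R) (x : 'M[R]_(m, d)) : R :=
  \sum_i f i (row i x).

Definition primal_norm (R : realType) (m d : nat)
    (nu : 'I_m -> 'rV[R]_d -> R) (x : 'M[R]_(m, d)) : R :=
  Num.sqrt (\sum_i nu i (row i x) ^+ 2).

Definition bigL_norm (R : realType) (m d : nat) (e : rel 'I_m)
    (nu : 'I_m -> 'rV[R]_d -> R) : R :=
  sup [set enorm (bigL e x) | x in [set x : 'M[R]_(m, d) | primal_norm nu x <= 1]].

Definition bigV (R : realType) (m d : nat) (w : 'I_m -> 'rV[R]_d -> R)
    (gw : 'I_m -> 'rV[R]_d -> 'rV[R]_d) (x u : 'M[R]_(m, d)) : R :=
  \sum_i bregman (w i) (gw i) (row i x) (row i u).

Definition optimal_solution (R : realType) (m d : nat) (e : rel 'I_m)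
    (X : 'I_m -> set 'rV[R]_d) (f : 'I_m -> 'rV[R]_d -> R)
    (x : 'M[R]_(m, d)) : Prop :=
  is_argmin [set z | in_prod X z /\ bigL e z = 0] (total_cost f) x.

Definition saddle_point (R : realType) (m d : nat) (e : rel 'I_m)
    (X : 'I_m -> set 'rV[R]_d) (f : 'I_m -> 'rV[R]_d -> R)
    (xs ys : 'M[R]_(m, d)) : Prop :=
  let lagrangian x y := total_cost f x + inner (bigL e x) y in
  in_prod X xs /\
  forall x y, in_prod X x ->
    lagrangian xs y <= lagrangian xs ys /\ lagrangian xs ys <= lagrangian x ys.

(* R^d with its Borel sigma-algebra. *)
Definition borelV (R : realType) (d : nat) :=
  g_sigma_algebraType (@open 'rV[R]_d).

Definition independent (R : realType) (d0 d1 d2 : measure_display)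
    (T : measurableType d0) (T1 : measurableType d1) (T2 : measurableType d2)
    (P : probability T R) (Y : T -> T1) (Z : T -> T2) : Prop :=
  forall A B, measurable A -> measurable B ->
    (P (Y @^-1` A `&` Z @^-1` B) = P (Y @^-1` A) * P (Z @^-1` B))%E.

(* One sample path of the method: g i k t v is the vector returned by the
   oracle of agent i at the point v in the (t+1)-st inner step of phase k, and
   u k t is the inner iterate u^{t,k}.  Since k.-2 = 0 for k = 1, x k.-2 then
   stands for x^{-1} = x^0. *)
Record sdcs_path (R : realType) (m d : nat) (e : rel 'I_m)
    (X : 'I_m -> set 'rV[R]_d)
    (w : 'I_m -> 'rV[R]_d -> R) (gw : 'I_m -> 'rV[R]_d -> 'rV[R]_d)
    (alpha tau eta : nat -> R) (lambda : nat -> R) (beta : nat -> nat -> R)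
    (T : nat -> nat) (N : nat) (x0 y0 : 'M[R]_(m, d))
    (g : 'I_m -> nat -> nat -> 'rV[R]_d -> 'rV[R]_d)
    (x xh y : nat -> 'M[R]_(m, d)) (u : nat -> nat -> 'M[R]_(m, d)) : Prop := {
  sdcs_init : [/\ x 0%N = x0, xh 0%N = x0 & y 0%N = y0];
  sdcs_dual : forall k, (1 <= k <= N)%N ->
    y k = y k.-1
          + (tau k)^-1 *: bigL e (alpha k *: (xh k.-1 - x k.-2) + x k.-1);
  sdcs_inner_init : forall k, (1 <= k <= N)%N -> u k 0%N = x k.-1;
  sdcs_inner : forall k t i, (1 <= k <= N)%N -> (1 <= t <= T k)%N ->
    let h := g i k t.-1 (row i (u k t.-1)) in
    is_argmin (X i)
      (fun v => inner (row i (bigL e (y k)) + h) v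
                + eta k * bregman (w i) (gw i) (row i (x k.-1)) v
                + eta k * beta k t
                  * bregman (w i) (gw i) (row i (u k t.-1)) v)
      (row i (u k t));
  sdcs_last : forall k, (1 <= k <= N)%N -> x k = u k (T k);
  sdcs_avg : forall k, (1 <= k <= N)%N ->
    xh k = (\sum_(1 <= t < (T k).+1) lambda t)^-1
           *: (\sum_(1 <= t < (T k).+1) lambda t *: u k t)
}.

(* Main.v *)
Require Import Defs.
From mathcomp Require Import all_boot all_order all_algebra.
From mathcomp Require Import ring lra.
From mathcomp Require Import all_classical all_reals all_analysis.
From mathcomp Require Import measurable_realfun.

Set Implicit Arguments.
Unset Strict Implicit.
Unset Printing Implicit Defensive.

Import Order.TTheory GRing.Theory Num.Theory.
Import numFieldNormedType.Exports.

Local Open Scope classical_set_scope.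
Local Open Scope ring_scope.

(* The inner loop is mirror descent with the weights [t]: the three-point
   inequality of the prox step, strong convexity and [V <= C/2 nu^2] make
   [t(t+1)/2 (eta + mu/C) V(u^t, z)] telescope, up to a second order error and a
   noise term [<Delta, z - u>], where [Delta] is the oracle error at the search
   point [u].  The outer loop is a primal-dual method with extrapolation: with the
   weights [k+1] both [V(x^k, z)] and [|y - y^k|^2] telescope, and the cross terms
   are absorbed because [k^2 <= 2 k (k-1)] for [k >= 2].  Everything up to here is
   a pathwise inequality whose only random right-hand side is a sum [W] of noise
   terms.  With the dual point [0] it bounds the optimality gap; with the dual
   point [y*] it bounds a positive definite quadratic form of the last extrapolation
   step and of [y* - y^N], hence the constraint violation, whose square root is
   linearized by [2 p <= p^2 / c + c] so that only the mean of [W] is needed.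

   The mean of [W] is controlled by conditioning on the search point, which is
   measurable because the prox step is Lipschitz in its linear part.  Integrability
   is free: strong convexity against the linear upper bound on the Bregman distance
   of [f_i] forces [X_i] to have diameter at most [2 M / mu]. *)

(** * Inner products, norms and the Laplacian *)

Section inner_product.
Variables (R : realType) (p q : nat).
Implicit Types (x y z : 'M[R]_(p, q)) (a : R).

Lemma innerC x y : inner x y = inner y x.
Proof. by apply: eq_bigr => i _; apply: eq_bigr => j _; rewrite mulrC. Qed.

Lemma innerDl x y z : inner (x + y) z = inner x z + inner y z.
Proof.
rewrite /inner -big_split /=; apply: eq_bigr => i _.
by rewrite -big_split /=; apply: eq_bigr => j _; rewrite mxE mulrDl.
Qed.

Lemma innerZl a x y : inner (a *: x) y = a * inner x y.
Proof.
rewrite /inner mulr_sumr; apply: eq_bigr => i _.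
by rewrite mulr_sumr; apply: eq_bigr => j _; rewrite mxE mulrA.
Qed.

Lemma innerDr x y z : inner x (y + z) = inner x y + inner x z.
Proof. by rewrite ![inner x _]innerC innerDl. Qed.

Lemma innerZr a x y : inner x (a *: y) = a * inner x y.
Proof. by rewrite ![inner x _]innerC innerZl. Qed.

Lemma innerNl x y : inner (- x) y = - inner x y.
Proof. by rewrite -scaleN1r innerZl mulN1r. Qed.

Lemma innerNr x y : inner x (- y) = - inner x y.
Proof. by rewrite innerC innerNl innerC. Qed.

Lemma innerBl x y z : inner (x - y) z = inner x z - inner y z.
Proof. by rewrite innerDl innerNl. Qed.

Lemma innerBr x y z : inner x (y - z) = inner x y - inner x z.
Proof. by rewrite innerDr innerNr. Qed.

Lemma inner0l x : inner 0 x = 0.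
Proof. by rewrite -(scale0r 0) innerZl mul0r. Qed.

Lemma inner0r x : inner x 0 = 0.
Proof. by rewrite innerC inner0l. Qed.

Lemma inner_sumr (I : Type) (r : seq I) x (F : I -> 'M[R]_(p, q)) :
  inner x (\sum_(i <- r) F i) = \sum_(i <- r) inner x (F i).
Proof.
by elim/big_rec2: _ => [|i y1 y2 _ <-]; rewrite ?inner0r ?innerDr.
Qed.

Lemma inner_ge0 x : 0 <= inner x x.
Proof. by do 2!apply: sumr_ge0 => ? _; rewrite -expr2 sqr_ge0. Qed.

Lemma sqr_enorm x : enorm x ^+ 2 = inner x x.
Proof. by rewrite sqr_sqrtr ?inner_ge0. Qed.

Lemma enorm_ge0 x : 0 <= enorm x.
Proof. exact: sqrtr_ge0. Qed.

Lemma enorm0 : enorm (0 : 'M[R]_(p, q)) = 0.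
Proof. by rewrite /enorm inner0l sqrtr0. Qed.

(** Cauchy-Schwarz: the square of [enorm y *: x - enorm x *: y] is expanded and divided by the
    product of the norms. A vanishing norm is treated apart. *)
Lemma ler_inner x y : inner x y <= enorm x * enorm y.
Proof.
have [y0|y0] := eqVneq (enorm y) 0.
  have /eqP := sqr_enorm y; rewrite y0 expr0n /= eq_sym => /eqP yy.
  rewrite mulr0 leNgt; apply/negP => xy.
  (* The multiple of [y] is chosen so that the square expands to -1. *)
  have := inner_ge0 (x - ((inner x x + 1) / inner x y / 2) *: y).
  rewrite innerBl !innerBr !innerZl !innerZr yy [inner y x]innerC.
  have -> : (inner x x + 1) / inner x y / 2 * inner x y = (inner x x + 1) / 2.
    by field; rewrite gt_eqF.
  lra.
have yp : 0 < enorm y by rewrite lt_neqAle eq_sym y0 enorm_ge0.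
have := inner_ge0 (enorm y *: x - enorm x *: y).
rewrite innerBl !innerBr !innerZl !innerZr [inner y x]innerC -!sqr_enorm.
have [x0|x0] := eqVneq (enorm x) 0.
  move=> _; have /eqP := sqr_enorm x; rewrite x0 expr0n /= eq_sym => /eqP xx.
  rewrite mul0r leNgt; apply/negP => xy.
  have := inner_ge0 (y - ((inner y y + 1) / inner x y / 2) *: x).
  rewrite innerBl !innerBr !innerZl !innerZr xx [inner y x]innerC.
  have -> : (inner y y + 1) / inner x y / 2 * inner x y = (inner y y + 1) / 2.
    by field; rewrite gt_eqF.
  lra.
have xp : 0 < enorm x by rewrite lt_neqAle eq_sym x0 enorm_ge0.
move=> h; have : 0 <= (enorm x * enorm y) * (enorm x * enorm y - inner x y) by lra.
by rewrite pmulr_rge0 ?mulr_gt0// subr_ge0.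
Qed.

Lemma enormZ a x : enorm (a *: x) = `|a| * enorm x.
Proof.
by rewrite /enorm innerZl innerZr mulrA -expr2 sqrtrM ?sqr_ge0// sqrtr_sqr.
Qed.

Lemma enormN x : enorm (- x) = enorm x.
Proof. by rewrite -scaleN1r enormZ normrN1 mul1r. Qed.

Lemma ler_enormD x y : enorm (x + y) <= enorm x + enorm y.
Proof.
rewrite -(@ler_pXn2r _ 2)// ?nnegrE ?addr_ge0 ?enorm_ge0//.
rewrite sqr_enorm innerDl !innerDr sqrrD -!sqr_enorm [inner y x]innerC.
by have := ler_inner x y; lra.
Qed.

Lemma inner_rows x y : inner x y = \sum_i inner (row i x) (row i y).
Proof.
apply: eq_bigr => i _; rewrite /inner big_ord1.
by apply: eq_bigr => j _; rewrite !mxE.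
Qed.

End inner_product.

Lemma ler_mx_norm_coord (R : realType) (p q : nat) (x : 'M[R]_(p, q)) i j :
  `|x i j| <= `|x|.
Proof.
rewrite [leRHS]/Num.norm /= mx_normrE.
by apply/bigmax_geP; right => /=; exists (i, j).
Qed.

Lemma mx_norm_lt (R : realType) (p q : nat) (x : 'M[R]_(p, q)) (c : R) :
  0 < c -> (forall i j, `|x i j| < c) -> `|x| < c.
Proof.
move=> c0 xc; rewrite [ltLHS]/Num.norm /= mx_normrE.
by apply/bigmax_ltP; split => // -[i j] _; exact: xc.
Qed.

Lemma ler_inner_mx_norm (R : realType) (p q : nat) (g x : 'M[R]_(p, q)) :
  `|inner g x| <= (\sum_i \sum_j `|g i j|) * `|x|.
Proof.
rewrite mulr_suml (le_trans (ler_norm_sum _ _ _))//; apply: ler_sum => i _.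
rewrite mulr_suml (le_trans (ler_norm_sum _ _ _))//; apply: ler_sum => j _.
by rewrite normrM ler_wpM2l// ler_mx_norm_coord.
Qed.

(** * Arbitrary norms on R^d and their duals *)

Section norms.
Variables (R : realType) (d : nat) (nu : 'rV[R]_d -> R).
Hypothesis nuP : is_norm nu.

Lemma norm_eq0 x : nu x = 0 -> x = 0.
Proof. by case: nuP => + _ _; exact. Qed.

Lemma norm_scale a x : nu (a *: x) = `|a| * nu x.
Proof. by case: nuP. Qed.

Lemma norm_triangle x y : nu (x + y) <= nu x + nu y.
Proof. by case: nuP. Qed.

Lemma norm_zero : nu 0 = 0.
Proof. by rewrite -(scale0r 0) norm_scale normr0 mul0r. Qed.

Lemma norm_opp x : nu (- x) = nu x.
Proof. by rewrite -scaleN1r norm_scale normrN1 mul1r. Qed.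

Lemma norm_distC x y : nu (x - y) = nu (y - x).
Proof. by rewrite -opprB norm_opp. Qed.

Lemma norm_ge0 x : 0 <= nu x.
Proof.
by have := norm_triangle x (- x); rewrite subrr norm_zero norm_opp; lra.
Qed.

Lemma norm_gt0 x : x != 0 -> 0 < nu x.
Proof.
by rewrite lt_neqAle norm_ge0 andbT [0 == _]eq_sym; apply: contra_neq => /norm_eq0.
Qed.

Lemma norm_le_mx_norm : exists2 c, 0 < c & forall x, nu x <= c * `|x|.
Proof.
(* The added 1 keeps the constant positive even if the sum is empty. *)
exists (\sum_j nu (delta_mx 0 j) + 1).
  by rewrite ltr_wpDl// sumr_ge0// => j _; exact: norm_ge0.
move=> x; rewrite mulrDl mul1r ler_wpDr// mulr_suml [x in nu x]row_sum_delta.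
elim/big_ind2: _ => [|a b c e ab ce|j _]; first by rewrite norm_zero.
  by rewrite (le_trans (norm_triangle _ _))// lerD.
by rewrite norm_scale mulrC ler_wpM2l ?norm_ge0 ?ler_mx_norm_coord.
Qed.

Lemma is_norm_continuous : continuous nu.
Proof.
have [c c0 nuc] := norm_le_mx_norm.
move=> x; suff : nu @ nbhs x --> nu x by [].
apply/cvgrPdist_lt => e e0.
have ce0 : 0 < e / c by rewrite divr_gt0.
apply/nbhs_ballP; exists (e / c) => //= y; rewrite -ball_normE /=.
rewrite ltr_pdivlMr// mulrC; apply: le_lt_trans.
have h1 := norm_triangle (x - y) y; have h2 := norm_triangle (y - x) x.
rewrite subrK in h1; rewrite subrK norm_distC in h2.
by rewrite (le_trans _ (nuc _))// ler_norml; apply/andP; split; lra.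
Qed.

(** Equivalence of norms: on the compact unit sphere of the sup norm, [nu] attains a minimum, which
    is positive by definiteness. Its inverse is the constant. *)
Lemma mx_norm_le_norm : exists2 c, 0 < c & forall x, `|x| <= c * nu x.
Proof.
pose S : set 'rV[R]_d := [set x | `|x| = 1].
(* An empty sphere means that 0 is the only vector. *)
have [S0|S0] := pselect (S !=set0); last first.
  exists 1 => // x; have [->|x0] := eqVneq x 0.
    by rewrite normr0 norm_zero mulr0.
  exfalso; apply: S0; exists (`|x|^-1 *: x).
  by rewrite /S /= normrZ normfV normr_id mulVf ?normr_eq0.
have Sco : compact S.
  apply: bounded_closed_compact.
    by exists 1; split => // r r1 x /= ->; exact: ltW.
  have -> : S = Num.norm @^-1` [set 1 : R] by [].
  by apply: closed_comp => [x _|]; [exact: norm_continuous|exact: closed_eq].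
have [c cS cmin] := EVT_min_rV S0 Sco (continuous_subspaceT is_norm_continuous).
have c0 : 0 < nu c.
  apply: norm_gt0; apply: contraTneq cS => ->.
  by rewrite notin_setE /S /= normr0 => /eqP; rewrite eq_sym oner_eq0.
exists (nu c)^-1; first by rewrite invr_gt0.
move=> x; have [->|x0] := eqVneq x 0; first by rewrite normr0 norm_zero mulr0.
have xp : 0 < `|x| by rewrite normr_gt0.
rewrite ler_pdivlMl// -ler_pdivlMr// mulrC -[`|x|^-1]gtr0_norm ?invr_gt0//.
rewrite -norm_scale cmin// inE /S /= normrZ normfV normr_id mulVf//.
by rewrite normr_eq0.
Qed.

Lemma dual_norm_has_sup g : has_sup [set inner g x | x in [set x | nu x <= 1]].
Proof.
have [c c0 cP] := mx_norm_le_norm; split.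
  by exists (inner g 0), 0 => //=; rewrite norm_zero.
exists ((\sum_i \sum_j `|g i j|) * c) => _ [x /= x1 <-].
rewrite (le_trans (ler_norm _))// (le_trans (ler_inner_mx_norm _ _))//.
rewrite ler_wpM2l//; first by do 2!apply: sumr_ge0 => ? _.
by rewrite (le_trans (cP x))// ler_piMr// ltW.
Qed.

Lemma ler_inner_dual g x : inner g x <= dual_norm nu g * nu x.
Proof.
have [->|x0] := eqVneq x 0; first by rewrite inner0r norm_zero mulr0.
have xp := norm_gt0 x0.
rewrite -ler_pdivrMr// mulrC -innerZr.
apply: sup_upper_bound; first exact: dual_norm_has_sup.
exists ((nu x)^-1 *: x) => //=.
by rewrite norm_scale ger0_norm ?invr_ge0 ?norm_ge0// mulVf// gt_eqF.
Qed.

Lemma dual_norm_le g c : 0 <= c -> (forall x, inner g x <= c * nu x) ->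
  dual_norm nu g <= c.
Proof.
move=> c0 gc; apply: ge_sup.
  by exists (inner g 0), 0 => //=; rewrite norm_zero.
by move=> _ [x /= x1 <-]; rewrite (le_trans (gc x))// ler_piMr.
Qed.

Lemma dual_norm_ge0 g : 0 <= dual_norm nu g.
Proof.
rewrite -(inner0r g); apply: sup_upper_bound; first exact: dual_norm_has_sup.
by exists 0 => //=; rewrite norm_zero.
Qed.

(** This makes the dual norm of a measurable oracle error measurable. *)
Lemma dual_norm_lip : exists2 c, 0 < c &
  forall g h, `|dual_norm nu g - dual_norm nu h| <= c * `|g - h|.
Proof.
have [c c0 cP] := mx_norm_le_norm.
pose c' := \sum_(i < 1) \sum_(j < d) c + 1.
have cs : 0 <= \sum_(i < 1) \sum_(j < d) c.
  by do 2!apply: sumr_ge0 => ? _; exact: ltW.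
have H g h : dual_norm nu g - dual_norm nu h <= c' * `|g - h|.
  rewrite lerBlDl; apply: dual_norm_le => [|x].
    by rewrite addr_ge0 ?dual_norm_ge0 ?mulr_ge0 ?addr_ge0.
  rewrite -[g in inner g](subrK h) addrC innerDl mulrDl lerD ?ler_inner_dual//.
  rewrite innerC (le_trans (ler_norm _))// (le_trans (ler_inner_mx_norm _ _))//.
  rewrite mulrAC ler_wpM2r// /c' mulrDl mul1r ler_wpDr ?norm_ge0//.
  rewrite mulr_suml; apply: ler_sum => i _; rewrite mulr_suml.
  apply: ler_sum => j _; apply: le_trans (cP x); exact: ler_mx_norm_coord.
exists c'; first by rewrite ltr_wpDl.
by move=> g h; rewrite ler_norml H andbT lerNl opprB distrC H.
Qed.

End norms.

(** * The Laplacian as an operator and its norm *)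

Lemma laplacian_sym (R : realType) (m : nat) (e : rel 'I_m) :
  symmetric e -> (laplacian R e)^T = laplacian R e.
Proof.
move=> e_sym; apply/matrixP => i j; rewrite !mxE.
by rewrite eq_sym e_sym; case: eqVneq => [->|].
Qed.

Lemma inner_trace (R : realType) (p q : nat) (x y : 'M[R]_(p, q)) :
  inner x y = \tr (x *m y^T).
Proof.
by apply: eq_bigr => i _; rewrite mxE; apply: eq_bigr => j _; rewrite mxE.
Qed.

Lemma bigL_selfadj (R : realType) (m d : nat) (e : rel 'I_m) :
  symmetric e -> forall x y : 'M[R]_(m, d),
  inner (bigL e x) y = inner x (bigL e y).
Proof.
move=> e_sym x y; rewrite !bigLE !inner_trace trmx_mul laplacian_sym//.
by rewrite -mulmxA mxtrace_mulC mulmxA.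
Qed.

Section bigL_linear.
Variables (R : realType) (m d : nat) (e : rel 'I_m).
Implicit Types x y : 'M[R]_(m, d).

Lemma bigLD x y : bigL e (x + y) = bigL e x + bigL e y.
Proof. by rewrite !bigLE mulmxDr. Qed.

Lemma bigLZ a x : bigL e (a *: x) = a *: bigL e x.
Proof. by rewrite !bigLE scalemxAr. Qed.

Lemma bigLB x y : bigL e (x - y) = bigL e x - bigL e y.
Proof. by rewrite !bigLE mulmxBr. Qed.

Lemma bigL0 : bigL e (0 : 'M[R]_(m, d)) = 0.
Proof. by rewrite bigLE mulmx0. Qed.

Lemma bigL_sum (I : Type) (r : seq I) (F : I -> 'M[R]_(m, d)) :
  bigL e (\sum_(i <- r) F i) = \sum_(i <- r) bigL e (F i).
Proof.
by elim/big_rec2: _ => [|i y1 y2 _ <-]; rewrite ?bigL0 ?bigLD.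
Qed.

End bigL_linear.

Section bigL_operator_norm.
Variables (R : realType) (m d : nat) (e : rel 'I_m).
Variable nu : 'I_m -> 'rV[R]_d -> R.
Hypothesis nuP : forall i, is_norm (nu i).
Implicit Types x y : 'M[R]_(m, d).

Lemma sqr_primal_norm x : primal_norm nu x ^+ 2 = \sum_i nu i (row i x) ^+ 2.
Proof. by rewrite sqr_sqrtr// sumr_ge0// => i _; exact: sqr_ge0. Qed.

Lemma primal_norm_ge0 x : 0 <= primal_norm nu x.
Proof. exact: sqrtr_ge0. Qed.

Lemma norm_row_le_primal x i : nu i (row i x) <= primal_norm nu x.
Proof.
rewrite -(@ler_pXn2r _ 2)// ?nnegrE ?primal_norm_ge0 ?(norm_ge0 (nuP i))//.
rewrite sqr_primal_norm (bigD1 i)//= ler_wpDr//.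
by rewrite sumr_ge0// => j _; exact: sqr_ge0.
Qed.

Lemma primal_normZ a x : primal_norm nu (a *: x) = `|a| * primal_norm nu x.
Proof.
rewrite /primal_norm -[in RHS]sqrtr_sqr -sqrtrM ?sqr_ge0//; congr Num.sqrt.
rewrite mulr_sumr; apply: eq_bigr => i _.
by rewrite linearZ /= (norm_scale (nuP i)) exprMn real_normK ?num_real.
Qed.

Lemma primal_norm_eq0 x : primal_norm nu x = 0 -> x = 0.
Proof.
move=> x0; apply/row_matrixP => i; rewrite row0; apply: (norm_eq0 (nuP i)).
apply/eqP; rewrite eq_le (norm_ge0 (nuP i)) andbT -x0.
exact: norm_row_le_primal.
Qed.

(** The supremum [bigL_norm] is meaningful only for a bounded set. Equivalence of norms, applied to
    each block, bounds every coordinate of [bigL e x]. *)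
Lemma bigL_norm_has_sup : has_sup
  [set enorm (bigL e x) | x in [set x : 'M[R]_(m, d) | primal_norm nu x <= 1]].
Proof.
split.
  exists 0, 0 => /=; last by rewrite bigL0 enorm0.
  rewrite /primal_norm big1 ?sqrtr0// => i _.
  by rewrite row0 (norm_zero (nuP i)) expr0n.
have /choice[c cP] : forall i, exists c, 0 < c /\ forall v, `|v| <= c * nu i v.
  by move=> i; have [c] := mx_norm_le_norm (nuP i); exists c.
pose B i := \sum_k `|laplacian R e i k| * c k.
have B0 i : 0 <= B i by apply: sumr_ge0 => k _; rewrite mulr_ge0// ltW// (cP k).1.
exists (Num.sqrt (\sum_(i < m) \sum_(j < d) B i ^+ 2)) => _ [x /= x1 <-].
rewrite ler_wsqrtr//; apply: ler_sum => i _; apply: ler_sum => j _.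
rewrite -expr2 -[leLHS]real_normK ?num_real// ler_sqr ?nnegrE//.
rewrite bigLE mxE (le_trans (ler_norm_sum _ _ _))//; apply: ler_sum => k _.
rewrite normrM ler_wpM2l//.
have -> : x k j = row k x 0 j by rewrite mxE.
rewrite (le_trans (ler_mx_norm_coord _ _ _))// (le_trans ((cP k).2 _))//.
rewrite -[leRHS]mulr1 ler_pM2l ?(cP k).1//.
exact: le_trans (norm_row_le_primal _ _) x1.
Qed.

Lemma enorm_bigL_le x : enorm (bigL e x) <= bigL_norm e nu * primal_norm nu x.
Proof.
have [x0|x0] := eqVneq (primal_norm nu x) 0.
  by rewrite (primal_norm_eq0 x0) bigL0 enorm0 -(primal_norm_eq0 x0) x0 mulr0.
have xp : 0 < primal_norm nu x by rewrite lt_neqAle eq_sym x0 primal_norm_ge0.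
have h : `|(primal_norm nu x)^-1| = (primal_norm nu x)^-1.
  by rewrite gtr0_norm ?invr_gt0.
rewrite -ler_pdivrMr// mulrC -h -enormZ -bigLZ.
apply: sup_upper_bound; first exact: bigL_norm_has_sup.
exists ((primal_norm nu x)^-1 *: x) => //=.
by rewrite primal_normZ h mulVf.
Qed.

Lemma inner_bigL_le x y :
  inner (bigL e x) y <= bigL_norm e nu * primal_norm nu x * enorm y.
Proof.
rewrite (le_trans (ler_inner _ _))// ler_wpM2r ?enorm_ge0//.
exact: enorm_bigL_le.
Qed.

(** Connectedness gives [i0] a neighbour [k]. The unit vector of block [k] then has image -1 in
    block [i0], so the operator is not zero. *)
Lemma bigL_norm_gt0 : (2 <= m)%N -> (1 <= d)%N ->
  (forall i j, connect e i j) -> 0 < bigL_norm e nu.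
Proof.
move=> m2 d1 e_conn.
pose i0 := Ordinal (ltnW m2); pose i1 := Ordinal m2; pose j0 := Ordinal d1.
(* Along a path from [i0] to [i1], possible loops at [i0] are skipped until the first step that
   leaves [i0]. *)
have [k k0 ek] : exists2 k, k != i0 & e i0 k.
  have /connectP[p] := e_conn i0 i1.
  elim: p => [_ /(congr1 val)//|k p IH] /= /andP[ek kp] lp.
  have [k0|k0] := eqVneq k i0; last by exists k.
  by apply: IH; rewrite -k0.
pose x : 'M[R]_(m, d) := delta_mx k j0.
have Lx : bigL e x i0 j0 = -1.
  rewrite bigLE mxE (bigD1 k)//= big1 => [|l lk].
    by rewrite !mxE !eqxx eq_sym (negbTE k0) ek mulr1 addr0.
  by rewrite !mxE (negbTE lk) mulr0.
have Lx0 : 0 < enorm (bigL e x).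
  rewrite sqrtr_gt0 /inner (bigD1 i0)//= (bigD1 j0)//= Lx.
  rewrite mulrN1 opprK -addrA ltr_wpDr// addr_ge0//.
    by apply: sumr_ge0 => j _; rewrite -expr2 sqr_ge0.
  by do 2!apply: sumr_ge0 => ? _; rewrite -expr2 sqr_ge0.
rewrite ltNge; apply/negP => L0.
have := lt_le_trans Lx0 (enorm_bigL_le x).
by rewrite ltNge mulr_le0_ge0// primal_norm_ge0.
Qed.

End bigL_operator_norm.

(** * Bregman distances and prox steps *)

Lemma convex_setP (R : realType) (d : nat) (X : set 'rV[R]_d) :
  convex_set X -> forall (x v : 'rV[R]_d) (s : R), X x -> X v -> 0 <= s <= 1 ->
  X (x + s *: (v - x)).
Proof.
move=> cX x v s Xx Xv s01.
have /andP[s0 s1] := s01.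
have := cX v x (Itv01 s0 s1); rewrite !inE => /(_ Xv Xx).
congr X; rewrite /conv /= /unstable.onem scalerBl scale1r scalerBr.
by rewrite addrCA.
Qed.

Lemma convex_comb (R : realType) (d : nat) (X : set 'rV[R]_d)
    (a : nat -> R) (x : nat -> 'rV[R]_d) (n : nat) :
  convex_set X -> (0 < n)%N ->
  (forall t, (1 <= t <= n)%N -> 0 < a t /\ X (x t)) ->
  X ((\sum_(1 <= t < n.+1) a t)^-1 *: \sum_(1 <= t < n.+1) a t *: x t).
Proof.
move=> cX; case: n => // n _; elim: n => [|n IH] H.
  have [a1 x1] := H 1%N isT.
  by rewrite !big_nat1 scalerA mulVf ?scale1r// gt_eqF.

rewrite big_nat_recr//= [X in _ *: X]big_nat_recr//=.
set A := (X in X + a n.+2); set B := (X in X + _ *: _).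
have A0 : 0 < A.
  rewrite /A big_nat_recl//=; apply: ltr_wpDr; last exact: (H 1%N isT).1.
  rewrite big_nat; apply: sumr_ge0 => t /andP[t1 tn].
  by apply: ltW; apply: (H t.+1 _).1; rewrite /= ltnS ltnW.
have [an xn] := H n.+2 (leqnn _).
have An : 0 < A + a n.+2 by exact: addr_gt0.
have s01 : 0 <= a n.+2 / (A + a n.+2) <= 1.
  apply/andP; split; first by rewrite divr_ge0// ltW.
  by rewrite ler_pdivrMr// mul1r lerDr ltW.
have xA : X (A^-1 *: B).
  by apply: IH => t /andP[t1 tn]; apply: H; rewrite t1 ltnW.
have := convex_setP cX xA xn s01.
suff -> : A^-1 *: B + a n.+2 / (A + a n.+2) *: (x n.+2 - A^-1 *: B) =
   (A + a n.+2)^-1 *: (B + a n.+2 *: x n.+2) by [].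
rewrite scalerBr addrCA scalerDr addrC !scalerA [a _ / _]mulrC.
congr (_ + _); rewrite -scalerBl; congr (_ *: _).
by field; rewrite !gt_eqF.
Qed.

(** Jensen's inequality from one affine minorant that touches [phi] at the weighted mean [c]: its
    linear part averages to zero there. *)
Lemma jensen_affine_minorant (R : realType) (d : nat) (phi : 'rV[R]_d -> R)
    (g c : 'rV[R]_d) (a : nat -> R) (x : nat -> 'rV[R]_d) (n : nat) :
  let A := \sum_(1 <= t < n.+1) a t in
  0 < A -> c = A^-1 *: \sum_(1 <= t < n.+1) a t *: x t ->
  (forall t, (1 <= t <= n)%N ->
     0 <= a t /\ phi c + inner g (x t - c) <= phi (x t)) ->
  A * phi c <= \sum_(1 <= t < n.+1) a t * phi (x t).
Proof.
move=> A A0 cE H.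
have : \sum_(1 <= t < n.+1) a t * (phi c + inner g (x t - c)) <=
       \sum_(1 <= t < n.+1) a t * phi (x t).
  by rewrite big_nat [leRHS]big_nat ler_sum// => t /H[a0 h]; rewrite ler_wpM2l.
apply: le_trans; rewrite (eq_bigr (fun t => a t * phi c +
  (inner g (a t *: x t) - a t * inner g c))); last first.
  by move=> t _; rewrite innerBr innerZr; ring.
rewrite big_split /= sumrB -!mulr_suml -inner_sumr -/A.
rewrite [X in inner g X](_ : _ = A *: c); last first.
  by rewrite cE scalerA mulfV ?scale1r// gt_eqF.
by rewrite innerZr subrr addr0.
Qed.

(** Bridge from epsilon-delta estimates along a segment of [X] to the derivative required by the
    mean value theorem. *)
Lemma is_derive_eps (R : realType) (f : R -> R) (s D : R) :
  (forall eps, 0 < eps -> exists2 del, 0 < del & forall h, `|h| < del ->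
     `|f (h + s) - f s - h * D| <= eps * `|h|) ->
  is_derive s 1 f D.
Proof.
move=> H.
have Hl : (fun h : R => h^-1 *: ((f \o shift s) (h *: (1:R)) - f s)) @ 0^' --> D.
  apply/cvgrPdist_le => eps /H[del del0 Hd].
  near=> h; have h0 : h != 0 by near: h; exact: nbhs_dnbhs_neq.
  have hd : `|h| < del by near: h; exact: dnbhs0_lt.
  have := Hd _ hd; rewrite /= -[X in X <= _]normrN => Hh.
  rewrite -(@ler_pM2r _ `|h|) ?normr_gt0// (le_trans _ Hh)//.
  rewrite -normrM le_eqVlt; apply/orP; left; apply/eqP; congr `|_|.
  by rewrite /= scaler1 /GRing.scale /=; field.
by apply: DeriveDef; [apply/cvg_ex; exists D|exact: cvg_lim].
Unshelve. all: by end_near. Qed.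

Lemma is_derive_quadratic (R : realType) (a b s : R) :
  is_derive s 1 (fun s : R => a * s + b * s ^+ 2) (a + b * (2 * s)).
Proof.
apply: is_derive_eps => eps eps0.
exists (eps / (`|b| + 1)); first by rewrite divr_gt0// ltr_wpDl.
move=> h; rewrite ltr_pdivlMr ?ltr_wpDl// => hd.
rewrite (_ : _ - _ = (b * h) * h); last by ring.
rewrite !normrM ler_wpM2r// mulrC.
by apply: le_trans (ltW hd); rewrite ler_wpM2l// lerDl.
Qed.

Section prox_function.
Variables (R : realType) (d : nat) (X : set 'rV[R]_d).
Hypothesis cX : convex_set X.
Variables (w : 'rV[R]_d -> R) (gw : 'rV[R]_d -> 'rV[R]_d).
Hypothesis wC1 : C1_on X w gw.

Lemma C1_eps x : X x -> forall eps, 0 < eps -> exists2 del, 0 < del &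
  forall v, X v -> `|v - x| < del ->
  `|w v - w x - inner (gw x) (v - x)| <= eps * `|v - x|.
Proof.
move=> Xx eps eps0; have [_ /(_ x Xx) /cvgrPdist_lt/(_ _ eps0)] := wC1.
rewrite /prop_near1 /= /within /= /dnbhs /within /=.
move=> /nbhs_ballP[del /= del0 H]; exists del => // v Xv vx.
have [->|vx0] := eqVneq v x.
  by rewrite !subrr inner0r subrr !normr0 mulr0.
have vb : ball x del v by rewrite -ball_normE /= distrC.
have := H v vb vx0 Xv; rewrite sub0r normrN normrM normfV normr_id.
by rewrite ltr_pdivrMr ?normr_gt0 ?subr_eq0// => /ltW.
Qed.

Lemma C1_gradient_eps x : X x -> forall eps, 0 < eps -> exists2 del, 0 < del &
  forall v, X v -> `|v - x| < del -> `|gw v - gw x| < eps.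
Proof.
move=> Xx eps eps0; have [/subspace_continuousP /(_ x Xx) + _] := wC1.
move=> /cvgrPdist_lt/(_ _ eps0); rewrite /prop_near1 /= /within /=.
move=> /nbhs_ballP[del /= del0 H]; exists del => // v Xv vx.
by rewrite distrC; apply: H => //; rewrite -ball_normE /= distrC.
Qed.

(** If the slope [A] towards [v] were negative, a short step from [z] along the segment, which stays
    in [X] by convexity, would lower the objective. Only differentiability relative to [X]
    enters. *)
Lemma argmin_first_order (q z : 'rV[R]_d) (kap : R) : 0 <= kap ->
  is_argmin X (fun v => inner q v + kap * w v) z ->
  forall v, X v -> 0 <= inner (q + kap *: gw z) (v - z).
Proof.
move=> kap0 [Xz zmin] v Xv; rewrite leNgt; apply/negP => A0.
set A := inner _ _ in A0.
have vz : 0 < `|v - z|.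
  rewrite normr_gt0; apply: contraTneq A0 => vz.
  by rewrite /A vz inner0r ltxx.
(* With this [eps] the first-order error along the segment costs at most half of the slope;
   [kap + 1] avoids dividing by zero when [kap = 0]. *)
pose eps := - A / (2 * (kap + 1) * `|v - z|).
have eps0 : 0 < eps.
  by rewrite divr_gt0 ?oppr_gt0// !mulr_gt0// ltr_wpDl.
have [del del0 H] := C1_eps Xz eps0.
pose s := Num.min 1 (del / 2 / `|v - z|).
have s0 : 0 < s by rewrite lt_min ltr01 !divr_gt0.
have s1 : s <= 1 by rewrite ge_min lexx.
have Xs : X (z + s *: (v - z)) by apply: convex_setP; rewrite ?(ltW s0).
have sd : s * `|v - z| < del.
  have : s <= del / 2 / `|v - z| by rewrite ge_min lexx orbT.
  rewrite ler_pdivlMr// => /le_lt_trans; apply; lra.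
have := zmin _ Xs; have := H _ Xs.
have -> : z + s *: (v - z) - z = s *: (v - z) by rewrite addrC addKr.
rewrite normrZ (gtr0_norm s0) => /(_ sd).
rewrite innerDr !innerZr => /ler_normlW h1 h2.
have h3 : kap * (w (z + s *: (v - z)) - w z) <=
   kap * (s * inner (gw z) (v - z) + eps * (s * `|v - z|)).
  by apply: ler_wpM2l => //; lra.
have h4 : 0 <= s * A + kap * (eps * (s * `|v - z|)).
  by rewrite /A innerDl innerZl; lra.
have : 0 <= A + kap * (eps * `|v - z|).
  rewrite -(@pmulr_rge0 _ s)//; apply: le_trans h4 _.
  by rewrite le_eqVlt; apply/orP; left; apply/eqP; ring.
have -> : kap * (eps * `|v - z|) = (kap / (kap + 1)) * (- A / 2).
  by rewrite /eps; field; rewrite ?gt_eqF// ltr_wpDl.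
have : kap / (kap + 1) * (- A / 2) <= 1 * (- A / 2).
  apply: ler_wpM2r; first lra.
  by rewrite ler_pdivrMr ?mul1r ?lerDl// ltr_wpDl.
lra.
Qed.

Variable nu : 'rV[R]_d -> R.
Hypothesis nuP : is_norm nu.
Hypothesis w_strong : forall v z, X v -> X z ->
  nu (v - z) ^+ 2 <= inner (gw v - gw z) (v - z).

(** On the segment from [x] to [v], subtract from [w] the linear part with slope [a] and the
    quadratic with coefficient [b]. By strong monotonicity the derivative
    [inner (gw (z s)) dv - a - 2 b s] is nonnegative for [0 < s < 1], and the mean value theorem
    concludes. *)
Lemma bregman_ge x v : X x -> X v -> nu (v - x) ^+ 2 / 2 <= bregman w gw x v.
Proof.
move=> Xx Xv; pose dv := v - x; pose a := inner (gw x) dv; pose b := nu dv ^+ 2 / 2.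
pose z (s : R) := x + s *: dv.
have Xz (s : R) : 0 <= s <= 1 -> X (z s) by exact: convex_setP.
pose phi (s : R) := w (z s).
have zB h s : z (h + s) - z s = h *: dv.
  by rewrite /z opprD addrACA subrr add0r scalerDl addrK.
have phi_eps (s : R) : 0 <= s <= 1 -> forall eps : R, 0 < eps ->
    exists2 del, 0 < del & forall h, 0 <= h + s <= 1 -> `|h| < del ->
     `|phi (h + s) - phi s - h * inner (gw (z s)) dv| <= eps * `|h|.
  move=> s01 eps eps0.
  have e0 : 0 < eps / (`|dv| + 1) by rewrite divr_gt0// ltr_wpDl.
  have [del del0 H] := C1_eps (Xz _ s01) e0.
  exists (del / (`|dv| + 1)); first by rewrite divr_gt0// ltr_wpDl.
  move=> h hs; rewrite ltr_pdivlMr ?ltr_wpDl// => hd.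
  have hd' : `|h| * `|dv| < del.
    by apply: le_lt_trans hd; rewrite ler_wpM2l// lerDl.
  have := H _ (Xz _ hs); rewrite zB normrZ innerZr => /(_ hd') h1.
  apply: le_trans h1 _.
  rewrite mulrAC ler_pdivrMr ?ltr_wpDl// -mulrA ler_wpM2l ?(ltW eps0)//.
  by rewrite ler_wpM2l// lerDl.
pose psi (s : R) := phi s - (a * s + b * s ^+ 2).
have dpsi (s : R) : s \in `]0, 1[%R ->
    is_derive s 1 psi (inner (gw (z s)) dv - (a + b * (2 * s))).
  rewrite in_itv /= => /andP[s0 s1].
  have dphi : is_derive s 1 phi (inner (gw (z s)) dv).
    apply: is_derive_eps => eps eps0.
    have [|del del0 H] := phi_eps s _ eps eps0; first by rewrite !ltW.
    (* The last two bounds keep [h + s] in the unit interval, where the expansion of [w] relative to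
       [X] is available. *)
    exists (Num.min del (Num.min s (1 - s))).
      by rewrite !lt_min del0 s0 subr_gt0.
    move=> h; rewrite !lt_min => /and3P[hd hs hs1]; apply: H => //.
    by move: hs hs1; rewrite !ltr_norml => /andP[? ?] /andP[? ?]; apply/andP; split; lra.
  have dpol := is_derive_quadratic a b s.
  exact: is_deriveB.
have cpsi : {within `[0, 1], continuous psi}.
  apply/subspace_continuousP => s; rewrite /= in_itv /= => s01.
  suff cphi : phi @ within `[0, 1] (nbhs s) --> phi s.
    apply: cvgB cphi _; apply: cvg_within_filter.
    apply: cvgD; first by apply: cvgMr; exact: cvg_id.
    by apply: cvgMr; exact: (@exprn_continuous R 2).
  apply/cvgrPdist_le => eps eps0.
  have [del del0 H] := phi_eps s s01 1 ltr01.
  set g := inner (gw (z s)) dv in H.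
  rewrite /prop_near1 /within /=; apply/nbhs_ballP.
  exists (Num.min del (eps / (`|g| + 1))) => /=.
    by rewrite lt_min del0 divr_gt0// ltr_wpDl.
  move=> r; rewrite /ball /= lt_min => /andP[rd re]; rewrite in_itv /= => r01.
  have := H (r - s); rewrite subrK distrC => /(_ r01 rd); rewrite mul1r => h.
  rewrite distrC.
  rewrite ltr_pdivlMr ?ltr_wpDl// in re; rewrite distrC in re.
  have := ler_normD (phi r - phi s - (r - s) * g) ((r - s) * g).
  rewrite subrK [`|(r - s) * g|]normrM => h1.
  rewrite (le_trans h1)// (le_trans _ (ltW re))// mulrDr mulr1 addrC lerD2l.
  by rewrite [`|r - s|]distrC.
have [c] := MVT ltr01 dpsi cpsi.
rewrite in_itv /= subr0 mulr1 => /andP[c0 c1].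
have c01 : 0 <= c <= 1 by rewrite !ltW.
have zc : z c - x = c *: dv by rewrite /z addrC addKr.
have := w_strong (Xz c c01) Xx; rewrite zc (norm_scale nuP) innerZr.
rewrite (gtr0_norm c0) exprMn expr2 -mulrA ler_pM2l// innerBl -/a => h.
have <- : phi 1 - phi 0 - a = bregman w gw x v.
  by rewrite /phi /z scale1r scale0r addr0 [x + dv]addrC /dv subrK.
have e2 : nu dv ^+ 2 = 2 * b by rewrite /b; field.
rewrite -/dv -/b; rewrite e2 in h; rewrite /psi; lra.
Qed.

End prox_function.

Definition inner_linE := (innerBl, innerBr, innerDl, innerDr, innerZl, innerZr,
  innerNl, innerNr).

Section bregman_theory.
Variables (R : realType) (d : nat) (X : set 'rV[R]_d).
Hypothesis cX : convex_set X.
Variables (w : 'rV[R]_d -> R) (gw : 'rV[R]_d -> 'rV[R]_d).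
Hypothesis wC1 : C1_on X w gw.
Variable nu : 'rV[R]_d -> R.
Hypothesis nuP : is_norm nu.
Hypothesis w_strong : forall v z, X v -> X z ->
  nu (v - z) ^+ 2 <= inner (gw v - gw z) (v - z).

Lemma bregman_ge0 x v : X x -> X v -> 0 <= bregman w gw x v.
Proof.
move=> Xx Xv; apply: le_trans (bregman_ge cX wC1 nuP w_strong Xx Xv).
by rewrite divr_ge0 ?sqr_ge0.
Qed.

Lemma bregman_three_point x z v :
  bregman w gw x v =
  bregman w gw x z + bregman w gw z v + inner (gw z - gw x) (v - z).
Proof. by rewrite /bregman !inner_linE; ring. Qed.

(** Up to a constant, both Bregman terms are linear plus a multiple of [w]. Every prox step thus
    becomes the minimization of a linear function plus [(eta + kap) * w]. *)
Lemma prox_argminE (p x v z : 'rV[R]_d) (eta kap : R) :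
  is_argmin X (fun u => inner p u + eta * bregman w gw x u
                        + kap * bregman w gw v u) z <->
  is_argmin X (fun u => inner (p - eta *: gw x - kap *: gw v) u
                        + (eta + kap) * w u) z.
Proof.
have E u : inner p u + eta * bregman w gw x u + kap * bregman w gw v u =
    inner (p - eta *: gw x - kap *: gw v) u + (eta + kap) * w u
    + (eta * (inner (gw x) x - w x) + kap * (inner (gw v) v - w v)).
  by rewrite /bregman !inner_linE; ring.
by split=> -[Xz H]; split=> // u /H; rewrite !E lerD2r.
Qed.

Lemma prox_three_point (p x v z : 'rV[R]_d) (eta kap : R) :
  0 <= eta + kap ->
  is_argmin X (fun u => inner p u + eta * bregman w gw x u
                        + kap * bregman w gw v u) z ->
  forall u, X u ->
  inner p (z - u) + eta * bregman w gw x z + kap * bregman w gw v z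
    + (eta + kap) * bregman w gw z u
  <= eta * bregman w gw x u + kap * bregman w gw v u.
Proof.
move=> ek /prox_argminE zmin u Xu.
have := argmin_first_order cX wC1 ek zmin Xu.
rewrite (bregman_three_point x z u) (bregman_three_point v z u).
by rewrite !inner_linE; lra.
Qed.

Lemma bregman_affine_minorant x c v : X c -> X v ->
  bregman w gw x c + inner (gw c - gw x) (v - c) <= bregman w gw x v.
Proof.
by move=> Xc Xv; rewrite (bregman_three_point x c v);
  have := bregman_ge0 Xc Xv; lra.
Qed.

(** Each optimality condition is tested at the other minimizer. Their sum and strong monotonicity
    give [kap * nu (z1 - z2) ^+ 2 <= inner (q2 - q1) (z1 - z2)], and equivalence of norms finishes.
    The estimate serves to prove that the iterates are measurable. *)
Lemma prox_stability (kap : R) : 0 < kap -> exists2 K, 0 < K &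
  forall q1 q2 z1 z2,
  is_argmin X (fun u => inner q1 u + kap * w u) z1 ->
  is_argmin X (fun u => inner q2 u + kap * w u) z2 ->
  `|z1 - z2| <= K * `|q1 - q2|.
Proof.
move=> kap0; have [c c0 cP] := mx_norm_le_norm nuP.
pose S : R := \sum_(i < 1) \sum_(j < d) 1 + 1.
have S0 : 0 < S by rewrite ltr_wpDl//; do 2!apply: sumr_ge0 => ? _.
exists (c ^+ 2 / kap * S); first by rewrite !mulr_gt0 ?invr_gt0 ?exprn_gt0.
move=> q1 q2 z1 z2 h1 h2.
have [Xz1 _] := h1; have [Xz2 _] := h2.
have := argmin_first_order cX wC1 (ltW kap0) h1 Xz2.
have := argmin_first_order cX wC1 (ltW kap0) h2 Xz1.
have := w_strong Xz1 Xz2.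
have : inner (q2 - q1) (z1 - z2) <=
    S * `|q1 - q2| * `|z1 - z2|.
  rewrite (le_trans (ler_norm _))// (le_trans (ler_inner_mx_norm _ _))//.
  rewrite ler_wpM2r// /S mulrDl mul1r ler_wpDr// mulr_suml.
  apply: ler_sum => i _; rewrite mulr_suml; apply: ler_sum => j _.
  by rewrite mul1r distrC ler_mx_norm_coord.
have := cP (z1 - z2).
rewrite !inner_linE.
move: (norm_ge0 nuP (z1 - z2)); set n := nu _ => n0 hn h3 h4 h5 h6.
have h7 : kap * n ^+ 2 <= S * `|q1 - q2| * `|z1 - z2|.
  by have := ler_wpM2l (ltW kap0) h4; lra.
have h8 : kap * n ^+ 2 <= (S * `|q1 - q2| * c) * n.
  apply: le_trans h7 _; rewrite -[leRHS]mulrA; apply: ler_wpM2l => //.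
  exact: mulr_ge0 (ltW S0) _.
have h9 : kap * n <= S * `|q1 - q2| * c.
  have [n00|n00] := eqVneq n 0.
    rewrite n00 mulr0; apply: mulr_ge0 (ltW c0).
    exact: mulr_ge0 (ltW S0) _.
  by rewrite -(@ler_pM2r _ n) ?lt_neqAle 1?eq_sym ?n00// -[leLHS]mulrA -expr2.
apply: le_trans hn _.
have -> : c ^+ 2 / kap * S * `|q1 - q2| = c * ((S * `|q1 - q2| * c) / kap).
  by ring.
by rewrite ler_pM2l// ler_pdivlMr// mulrC.
Qed.

End bregman_theory.

(** * The inner loop *)

Lemma inner_weights_sum (R : realType) (n : nat) :
  \sum_(1 <= t < n.+1) t%:R = n%:R * (n%:R + 1) / 2 :> R.
Proof.
elim: n => [|n IH]; first by rewrite big_nil !mul0r.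
by rewrite big_nat_recr//= IH -natr1; field.
Qed.

Section inner_loop.
Variables (R : realType) (d : nat) (X : set 'rV[R]_d).
Hypothesis cX : convex_set X.
Variable nu : 'rV[R]_d -> R.
Hypothesis nuP : is_norm nu.
Variables mu M C eta : R.
Hypotheses (mu_gt0 : 0 < mu) (C_gt0 : 0 < C) (eta_gt0 : 0 < eta).
Variables (f : 'rV[R]_d -> R) (f' : 'rV[R]_d -> 'rV[R]_d).
Hypothesis f_bounds : forall v z, X v -> X z ->
  mu / 2 * nu (v - z) ^+ 2 <= f v - f z - inner (f' z) (v - z)
  /\ f v - f z - inner (f' z) (v - z) <= M * nu (v - z).
Variables (w : 'rV[R]_d -> R) (gw : 'rV[R]_d -> 'rV[R]_d).
Hypothesis wC1 : C1_on X w gw.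
Hypothesis w_strong : forall v z, X v -> X z ->
  nu (v - z) ^+ 2 <= inner (gw v - gw z) (v - z).
Hypothesis w_growth : forall v z, X v -> X z ->
  bregman w gw v z <= C / 2 * nu (v - z) ^+ 2.
Variables (p x z : 'rV[R]_d) (u h : nat -> 'rV[R]_d).
Hypothesis Xz : X z.

Let V := bregman w gw.
Let Phi v := inner p v + f v + eta * V x v.

(** Strong convexity and quadratic growth provide the gain [mu / C * V v' z]. The noise is split at
    [v']: the part against [z - v'] is kept since its mean vanishes, and the part against [v' - v]
    joins [M] as a linear term in [nu (v - v')]. Young's inequality absorbs that term into
    [c * V v' v]. *)
Lemma inner_step (c : R) (v v' g : 'rV[R]_d) : 0 < c -> X v' ->
  is_argmin X (fun u => inner (p + g) u + eta * V x u + c * V v' u) v ->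
  Phi v - Phi z <=
    (c - mu / C) * V v' z - (eta + c) * V v z
    + (M + dual_norm nu (g - f' v')) ^+ 2 / (2 * c)
    + inner (g - f' v') (z - v').
Proof.
move=> c0 Xv' vmin; have [Xv _] := vmin.
have := prox_three_point cX wC1 (ltW (addr_gt0 eta_gt0 c0)) vmin Xz.
have := bregman_ge cX wC1 nuP w_strong Xv' Xv.
have := (f_bounds Xv Xv').2.
have := (f_bounds Xz Xv').1.
have : V v' z * (mu / C) <= mu / 2 * nu (z - v') ^+ 2.
  rewrite (norm_distC nuP) -ler_pdivlMr ?divr_gt0//.
  apply: le_trans (w_growth Xv' Xz) _; rewrite le_eqVlt; apply/orP; left.
  by apply/eqP; field; rewrite !gt_eqF.
have : inner (g - f' v') (v' - v) <= dual_norm nu (g - f' v') * nu (v - v').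
  by rewrite (norm_distC nuP); exact: ler_inner_dual.
set dl := dual_norm _ _; set n := nu (v - v') => h1 h2 h3 h4 h5.
have young : (M + dl) * n - c * (n ^+ 2 / 2) <= (M + dl) ^+ 2 / (2 * c).
  rewrite ler_pdivlMr ?mulr_gt0//.
  rewrite -subr_ge0 (_ : _ - _ = (M + dl - c * n) ^+ 2) ?sqr_ge0//.
  by field.
have h6 : c * (n ^+ 2 / 2) <= c * V v' v by rewrite ler_pM2l.
rewrite /Phi -/V; move: h1 h3 h4.
rewrite !inner_linE; rewrite -/V in h5 h6 *; lra.
Qed.

Hypothesis (Xu0 : X (u 0%N)).
(** This is [eta] times the inner prox parameter, after cancellation of [eta] in its first
    summand. *)
Let c (t : nat) := t.+1%:R * mu / (2 * C) + eta * ((t%:R - 1) / 2).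
Let err t := (M + dual_norm nu (h t - f' (u t))) ^+ 2 / (2 * c t.+1)
             + inner (h t - f' (u t)) (z - u t).

(** Telescoping rests on [t (c t - mu / C) = t (t - 1) / 2 (eta + mu / C)] and [t (eta + c t) = t (t
    + 1) / 2 (eta + mu / C)]: after weighting by [t], what step [t] spends is exactly what step
    [t - 1] left over. *)
Lemma inner_loop_sum (n : nat) :
  (forall t, (1 <= t <= n)%N ->
    is_argmin X (fun v => inner (p + h t.-1) v + eta * V x v
                        + c t * V (u t.-1) v) (u t)) ->
  (\sum_(1 <= t < n.+1) t%:R * (Phi (u t) - Phi z))
    + n%:R * (n%:R + 1) / 2 * (eta + mu / C) * V (u n) z
  <= \sum_(1 <= t < n.+1) t%:R * err t.-1.
Proof.
elim: n => [|n IH] H; first by rewrite !big_nil !mul0r addr0.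
rewrite big_nat_recr//= [leRHS]big_nat_recr//=.
have Xun : X (u n).
  by case: n H {IH} => [//|n] H; have [] := H n.+1 (leqnSn _).
have c0 : 0 < c n.+1.
  rewrite /c ltr_wpDr// ?divr_gt0 ?mulr_gt0 ?ltr0n//.
  by rewrite !mulr_ge0 ?invr_ge0 ?(ltW eta_gt0)// subr_ge0 ler1n.
have Hn := H n.+1 (leqnn _).
have h1 : Phi (u n.+1) - Phi z <= (c n.+1 - mu / C) * V (u n) z
    - (eta + c n.+1) * V (u n.+1) z + err n.
  by have := inner_step c0 Xun Hn; rewrite /err; lra.
have : n.+1%:R * (Phi (u n.+1) - Phi z) <=
   n%:R * (n%:R + 1) / 2 * (eta + mu / C) * V (u n) z
   - n.+1%:R * (n.+1%:R + 1) / 2 * (eta + mu / C) * V (u n.+1) z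
   + n.+1%:R * err n.
  apply: le_trans (ler_wpM2l (ler0n _ _) h1) _.
  rewrite le_eqVlt; apply/orP; left; apply/eqP.
  by rewrite /c -!natr1; field; rewrite gt_eqF.
suff : forall t, (1 <= t <= n)%N -> is_argmin X
  (fun v => inner (p + h t.-1) v + eta * V x v + c t * V (u t.-1) v) (u t).
  by move=> /IH; lra.
by move=> t /andP[t1 tn]; apply: H; rewrite t1 leqW.
Qed.

Lemma inner_loop (n : nat) (xh : 'rV[R]_d) : (0 < n)%N ->
  (forall t, (1 <= t <= n)%N ->
    is_argmin X (fun v => inner (p + h t.-1) v + eta * V x v
                        + c t * V (u t.-1) v) (u t)) ->
  xh = (\sum_(1 <= t < n.+1) t%:R)^-1 *: \sum_(1 <= t < n.+1) t%:R *: u t ->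
  f xh - f z + inner p (xh - z) + eta * (V x xh - V x z)
    + (eta + mu / C) * V (u n) z
  <= (\sum_(1 <= t < n.+1) t%:R)^-1 * \sum_(1 <= t < n.+1) t%:R * err t.-1.
Proof.
move=> n0 H xhE.
have Xu t : (1 <= t <= n)%N -> X (u t) by move=> /H[].
have Xxh : X xh.
  by rewrite xhE; apply: convex_comb => // t tn; split; [case: t tn => // t|exact: Xu].
have A0 : 0 < \sum_(1 <= t < n.+1) t%:R :> R.
  by rewrite inner_weights_sum !mulr_gt0 ?ltr_wpDl ?ltr0n ?invr_gt0.
have : (\sum_(1 <= t < n.+1) t%:R) * Phi xh <= \sum_(1 <= t < n.+1) t%:R * Phi (u t).
  (* The slope adds up the linear part, the subgradient of [f] at [xh], and the derivative of
     [eta * V x] at [xh]. *)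
  apply: (@jensen_affine_minorant _ _ _ (p + f' xh + eta *: (gw xh - gw x)) _ _ _ _ A0 xhE).
  move=> t tn; split; first exact: ler0n.
  have h1 := bregman_affine_minorant cX wC1 nuP w_strong x Xxh (Xu _ tn).
  have h2 := (f_bounds (Xu _ tn) Xxh).1.
  have h3 : 0 <= mu / 2 * nu (u t - xh) ^+ 2.
    by rewrite mulr_ge0 ?sqr_ge0// divr_ge0// ltW.
  rewrite -/V in h1; have h4 := ler_wpM2l (ltW eta_gt0) h1.
  move: h2 h4; rewrite /Phi !inner_linE; lra.
have := inner_loop_sum H.
rewrite (eq_bigr (fun t => t%:R * Phi (u t) - t%:R * Phi z)); last first.
  by move=> t _; rewrite mulrBr.
rewrite sumrB -mulr_suml -inner_weights_sum => h1 h2.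
rewrite [leRHS]mulrC ler_pdivlMr// mulrC.
by move: h1 h2; rewrite /Phi !inner_linE; set A := \sum_(1 <= t < n.+1) t%:R; lra.
Qed.

End inner_loop.

(** * The outer loop *)

Lemma enormD_sqr (R : realType) (p q : nat) (x y : 'M[R]_(p, q)) :
  enorm (x + y) ^+ 2 = enorm x ^+ 2 + 2 * inner x y + enorm y ^+ 2.
Proof. by rewrite !sqr_enorm innerDl !innerDr [inner y x]innerC; ring. Qed.

Section outer_loop.
Variables (R : realType) (m d : nat) (e : rel 'I_m).
Hypothesis e_sym : symmetric e.
Variable nu : 'I_m -> 'rV[R]_d -> R.
Hypothesis nuP : forall i, is_norm (nu i).
Let l := bigL_norm e nu.
Hypothesis l_gt0 : 0 < l.
Variables mu C : R.
Hypotheses (mu_gt0 : 0 < mu) (C_gt0 : 0 < C).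
Variables (N : nat) (x xh y : nat -> 'M[R]_(m, d)) (z : 'M[R]_(m, d)).
Variables (E : nat -> R) (F : 'M[R]_(m, d) -> R).
Variable V : 'M[R]_(m, d) -> 'M[R]_(m, d) -> R.
Let eta (k : nat) : R := k%:R * mu / (2 * C).
Let tau (k : nat) : R := 4 * l ^+ 2 * C / (k.+1%:R * mu).
Let alpha (k : nat) : R := k%:R / k.+1%:R.
(** Half of [k.+1%:R * tau k], which is the same for all [k]; this is why the squared dual distances
    telescope. *)
Let K := 2 * l ^+ 2 * C / mu.
Hypothesis V_ge : forall k, (1 <= k <= N)%N ->
  primal_norm nu (xh k - x k.-1) ^+ 2 / 2 <= V (x k.-1) (xh k).
Hypothesis V_ge0 : forall k, (0 <= k <= N)%N -> 0 <= V (x k) z.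
Hypothesis Lz : bigL e z = 0.
Hypothesis xh0 : xh 0%N = x 0%N.
Hypothesis yE : forall k, (1 <= k <= N)%N -> y k = y k.-1
  + (tau k)^-1 *: bigL e (alpha k *: (xh k.-1 - x k.-2) + x k.-1).
Hypothesis phase : forall k, (1 <= k <= N)%N ->
  F (xh k) - F z + inner (bigL e (y k)) (xh k - z)
    + eta k * (V (x k.-1) (xh k) - V (x k.-1) z) + (eta k + mu / C) * V (x k) z
  <= E k.

(** The extrapolation step. As [0.-1 = 0], it vanishes at [k = 0] by [xh0]. *)
Let a k := xh k - x k.-1.

Let K_gt0 : 0 < K.
Proof. by rewrite divr_gt0// !mulr_gt0// exprn_gt0. Qed.

Let eta_mu_ge0 k : 0 <= eta k + mu / C.
Proof. by rewrite addr_ge0 ?divr_ge0 ?mulr_ge0// ltW. Qed.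

(** The dual update solved for [bigL e (xh k)]: the extrapolated point differs from [xh k] by
    [a k - alpha k *: a k.-1]. Since [k.+1%:R * alpha k = k], the correction telescopes. *)
Lemma dual_step k : (1 <= k <= N)%N ->
  k.+1%:R *: bigL e (xh k) =
  (2 * K) *: (y k - y k.-1) + k.+1%:R *: bigL e (a k) - k%:R *: bigL e (a k.-1).
Proof.
move=> kN; rewrite (yE kN) [y k.-1 + _]addrC addrK scalerA.
have -> : 2 * K * (tau k)^-1 = k.+1%:R.
  by rewrite /K /tau; field; rewrite !gt_eqF ?ltr0n.
rewrite -!bigLZ -bigLD -bigLB; congr (bigL e _).
rewrite /a /alpha; apply/matrixP => i j; rewrite !mxE.
by field; rewrite nat1r pnatr_eq0.
Qed.

(** Completing the square in [enorm v] leaves [primal_norm nu (a n) ^+ 2] with a coefficient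
    proportional to [2 k (k - 1) - k ^ 2] for [k = n + 1], which is nonnegative once [k >= 2]. For
    [n = 0] the step [a 0] is zero. *)
Lemma cross_term n v : n.+1%:R * inner (bigL e (a n)) v <=
  K * enorm v ^+ 2 + n.+1%:R * eta n / 2 * primal_norm nu (a n) ^+ 2.
Proof.
case: n => [|n].
  rewrite /a /= xh0 subrr bigL0 inner0l mulr0 /eta !mul0r mulr0 mul0r mul0r addr0.
  by rewrite mulr_ge0 ?sqr_ge0// ltW.
set b := enorm v; set p := primal_norm nu _.
have h := inner_bigL_le e nuP (a n.+1) v; rewrite -/l -/p -/b in h.
apply: le_trans (ler_wpM2l (ler0n R n.+2) h) _.
rewrite -subr_ge0.
have -> : K * b ^+ 2 + n.+2%:R * eta n.+1 / 2 * p ^+ 2 - n.+2%:R * (l * p * b)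
  = K * (b - n.+2%:R * l * p / (2 * K)) ^+ 2
    + n%:R * n.+2%:R * mu / (8 * C) * p ^+ 2.
  by rewrite /K /eta -!natr1; field; rewrite !gt_eqF.
apply: addr_ge0; first by rewrite mulr_ge0 ?sqr_ge0// ltW.
by rewrite mulr_ge0 ?sqr_ge0// divr_ge0// ?mulr_ge0// ltW.
Qed.

(** The primal distances match because [k.+1%:R * eta k = k%:R * (eta k.-1 + mu / C)]. The dual step
    tested against [Y - y k] produces a difference of squared dual distances minus
    [K * enorm (y k - y k.-1) ^+ 2]. This loss, and the quadratic term in [a k.-1] saved from the
    previous phase, pay for the cross term. *)
Lemma outer_loop_sum (Y : 'M[R]_(m, d)) n : (n <= N)%N ->
  \sum_(1 <= k < n.+1) k.+1%:R * (F (xh k) - F z + inner (bigL e (xh k)) Y)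
  + n.+1%:R * (eta n + mu / C) * V (x n) z + K * enorm (Y - y n) ^+ 2
  + n.+1%:R * eta n / 2 * primal_norm nu (a n) ^+ 2
  - n.+1%:R * inner (bigL e (a n)) (Y - y n)
  <= mu / C * V (x 0%N) z + K * enorm (Y - y 0%N) ^+ 2
  + \sum_(1 <= k < n.+1) k.+1%:R * E k.
Proof.
elim: n => [_|n IH nN].
  rewrite !big_nil /eta /a /= xh0 subrr bigL0 inner0l; lra.
have {}IH := IH (ltnW nN).
have k1 : (1 <= n.+1 <= N)%N by [].
rewrite big_nat_recr//= [in leRHS]big_nat_recr//=.
have h1 := ler_wpM2l (ler0n R n.+2) (phase k1).
have eta0 : 0 <= eta n.+1 by rewrite divr_ge0// mulr_ge0// ltW.
have h2 := ler_wpM2l (ler0n R n.+2) (ler_wpM2l eta0 (V_ge k1)).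
set b := enorm (y n.+1 - y n).
have b0 : 0 <= b := enorm_ge0 _.
set p := primal_norm nu (a n).
have p0 : 0 <= p := primal_norm_ge0 _ _.
have h3 := cross_term n (y n.+1 - y n); rewrite -/b -/p in h3.
have h4 := congr1 (fun v => inner v (Y - y n.+1)) (dual_step k1).
rewrite /= 2!innerDl innerNl !innerZl in h4.
have e1 : n.+2%:R * eta n.+1 = n.+1%:R * (eta n + mu / C).
  by rewrite /eta -!natr1; field; rewrite gt_eqF.
have e2 : inner (bigL e (y n.+1)) (xh n.+1 - z) = inner (bigL e (xh n.+1)) (y n.+1).
  by rewrite (bigL_selfadj e_sym) bigLB Lz subr0 innerC.
rewrite e2 /= in h1.
have e3 : inner (bigL e (xh n.+1)) Y =
    inner (bigL e (xh n.+1)) (Y - y n.+1) + inner (bigL e (xh n.+1)) (y n.+1).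
  by rewrite -innerDr subrK.
have e4 : Y - y n = (y n.+1 - y n) + (Y - y n.+1) by rewrite [RHS]addrC addrA subrK.
have e5 : enorm (Y - y n) ^+ 2 = b ^+ 2
    + 2 * inner (y n.+1 - y n) (Y - y n.+1) + enorm (Y - y n.+1) ^+ 2.
  by rewrite e4; exact: enormD_sqr.
have e6 : inner (bigL e (a n)) (Y - y n) = inner (bigL e (a n)) (y n.+1 - y n)
    + inner (bigL e (a n)) (Y - y n.+1).
  by rewrite e4 innerDr.
rewrite e5 e6 in IH; rewrite e3.
rewrite -/(a n.+1) in h2.
rewrite /= in h4.
set t2 := n.+2%:R in h1 h2 h4 e1 *; set t1 := n.+1%:R in h3 h4 e1 IH *.
set X1 := t2 * eta n.+1 in e1.
have {}h1 : t2 * (F (xh n.+1) - F z + inner (bigL e (xh n.+1)) (y n.+1))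
    + X1 * (V (x n) (xh n.+1) - V (x n) z) + t2 * (eta n.+1 + mu / C) * V (x n.+1) z
    <= t2 * E n.+1.
  by move: h1; rewrite /X1; lra.
have {}h2 : X1 / 2 * primal_norm nu (a n.+1) ^+ 2 <= X1 * V (x n) (xh n.+1).
  by move: h2; rewrite /X1; lra.
rewrite -/X1 -e1 in IH *.
rewrite -/p in IH; move: IH h1 h2 h3 h4; lra.
Qed.
(** The dual point is 0, which removes the constraint term. The one cross term left at the end is
    again covered by [cross_term]. *)
Lemma outer_primal_gap :
  \sum_(1 <= k < N.+1) k.+1%:R * (F (xh k) - F z)
  <= mu / C * V (x 0%N) z + K * enorm (y 0%N) ^+ 2
     + \sum_(1 <= k < N.+1) k.+1%:R * E k.
Proof.
have := outer_loop_sum 0 (leqnn N); have := cross_term N (0 - y N).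
under eq_bigr do rewrite inner0r addr0.
have : 0 <= N.+1%:R * (eta N + mu / C) * V (x N) z.
  by rewrite mulr_ge0 ?V_ge0 ?leqnn// mulr_ge0// eta_mu_ge0.
rewrite !sub0r !enormN; lra.
Qed.

Hypothesis N_ge2 : (2 <= N)%N.
Variable Y : 'M[R]_(m, d).
Hypothesis saddle : forall k, (1 <= k <= N)%N ->
  0 <= F (xh k) - F z + inner (bigL e (xh k)) Y.
Let B0 := mu / C * V (x 0%N) z + K * enorm (Y - y 0%N) ^+ 2
     + \sum_(1 <= k < N.+1) k.+1%:R * E k.
Let a_N := primal_norm nu (a N).
Let b_N := enorm (Y - y N).

(* The constant 52 is the value of [v A^-1 v] for [v = (2, 1)] and
   [A = ((1, -1/2), (-1/2, 1/3))]. *)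
Lemma outer_last_iterate :
  (2 * K * b_N + N.+1%:R * l * a_N) ^+ 2 <= 52 * K * B0.
Proof.
have := outer_loop_sum Y (leqnn N); rewrite -/B0 -/a_N -/b_N.
have : 0 <= N.+1%:R * (eta N + mu / C) * V (x N) z.
  by rewrite mulr_ge0 ?V_ge0 ?leqnn// mulr_ge0// eta_mu_ge0.
have : 0 <= \sum_(1 <= k < N.+1) k.+1%:R * (F (xh k) - F z + inner (bigL e (xh k)) Y).
  by rewrite big_nat; apply: sumr_ge0 => k kN; rewrite mulr_ge0// saddle.
have h := inner_bigL_le e nuP (a N) (Y - y N); rewrite -/l -/a_N -/b_N in h.
have {}h := ler_wpM2l (ler0n R N.+1) h.
move=> h1 h2 h3.
set s := N.+1%:R * l * a_N.
have e1 : N.+1%:R * eta N / 2 * a_N ^+ 2 = N%:R / N.+1%:R / (2 * K) * s ^+ 2.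
  by rewrite /s /eta /K; field; rewrite !gt_eqF.
(* Here [N / (N + 1) >= 2 / 3], because [N >= 2]. *)
have h4 : s ^+ 2 / (3 * K) <= N.+1%:R * eta N / 2 * a_N ^+ 2.
  have K2 : 0 < 2 * K by apply: mulr_gt0 => //; exact: K_gt0.
  rewrite e1 mulrC ler_wpM2r ?sqr_ge0// ler_pdivlMr//.
  rewrite ler_pdivlMr ?ltr0n// (_ : _ * _ = 2 / 3 * N.+1%:R); last first.
    by field; rewrite gt_eqF.
  have : (2:R) <= N%:R by rewrite ler_nat.
  by rewrite -natr1; lra.
have h5 : K * b_N ^+ 2 - b_N * s + s ^+ 2 / (3 * K) <= B0 by move: h4; rewrite /s; lra.
rewrite -subr_ge0.
(* The constant 52 is exactly what turns the remainder into a perfect square. *)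
have -> : 52 * K * B0 - (2 * K * b_N + s) ^+ 2 =
   52 * K * (B0 - (K * b_N ^+ 2 - b_N * s + s ^+ 2 / (3 * K)))
   + (12 * K * b_N - 7 * s) ^+ 2 / 3.
  by field; rewrite gt_eqF.
apply: addr_ge0; last by rewrite divr_ge0 ?sqr_ge0.
by apply: mulr_ge0; [exact: mulr_ge0 (ltW K_gt0)|rewrite subr_ge0].
Qed.

(** The sum of [dual_step] over the phases: the dual increments and the corrections both telescope,
    and [a 0 = 0]. *)
Lemma bigL_weighted_sum n : (n <= N)%N ->
  \sum_(1 <= k < n.+1) k.+1%:R *: bigL e (xh k) =
  (2 * K) *: (y n - y 0%N) + n.+1%:R *: bigL e (a n).
Proof.
elim: n => [_|n IH nN].
  by rewrite big_nil subrr scaler0 add0r /a /= xh0 subrr bigL0 scaler0.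
rewrite big_nat_recr//= IH 1?ltnW// dual_step//=.
by apply/matrixP => i j; rewrite !mxE; ring.
Qed.

(** The dual displacement is split at [Y], and [outer_last_iterate] controls the rest. For fixed
    [c0] the bound is affine in [B0], hence in the errors [E], so expectations can be taken. *)
Lemma outer_feasibility (c0 : R) : 0 < c0 ->
  enorm (\sum_(1 <= k < N.+1) k.+1%:R *: bigL e (xh k))
  <= 2 * K * enorm (Y - y 0%N) + (52 * K * B0 / c0 + c0) / 2.
Proof.
move=> c00; rewrite bigL_weighted_sum//.
have -> : y N - y 0%N = (Y - y 0%N) - (Y - y N).
  by apply/matrixP => i j; rewrite !mxE; ring.
apply: le_trans (ler_enormD _ _) _; rewrite !enormZ.
have K2 : 0 < 2 * K by apply: mulr_gt0 => //; exact: K_gt0.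
rewrite (gtr0_norm K2) ger0_norm//.
have h1 := ler_enormD (Y - y 0%N) (- (Y - y N)).
rewrite enormN -/b_N in h1.
have h2 := ler_wpM2l (ler0n R N.+1) (enorm_bigL_le e nuP (a N)).
rewrite -/l -/a_N in h2.
have {}h1 := ler_wpM2l (ltW K2) h1.
have h3 : (2 * K * b_N + N.+1%:R * l * a_N) <= (52 * K * B0 / c0 + c0) / 2.
  set P := _ + _; have h4 : P ^+ 2 / c0 <= 52 * K * B0 / c0.
    by rewrite ler_wpM2r ?invr_ge0 ?(ltW c00)// outer_last_iterate.
  suff : P <= (P ^+ 2 / c0 + c0) / 2 by lra.
  rewrite -subr_ge0 (_ : _ - _ = (P - c0) ^+ 2 / c0 / 2); last first.
    by field; rewrite gt_eqF.
  by rewrite !divr_ge0 ?sqr_ge0// ltW.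
lra.
Qed.

End outer_loop.

(** * The error budget *)

Section budget.
Variables (R : realType) (mu C D A : R) (N : nat).
Hypotheses (mu_gt0 : 0 < mu) (C_gt0 : 0 < C) (D_gt0 : 0 < D) (A_gt0 : 0 < A).
Hypothesis N_ge2 : (2 <= N)%N.
Let r := Num.sqrt (A / D).
Let c (k t : nat) : R :=
  t.+1%:R * mu / (2 * C) + k%:R * mu / (2 * C) * ((t%:R - 1) / 2).

Lemma phase_weight_gt0 k t : 0 < c k t.+1.
Proof.
rewrite /c ltr_wpDr// ?divr_gt0 ?mulr_gt0 ?ltr0n//.
by rewrite !mulr_ge0 ?invr_ge0 ?subr_ge0 ?ler1n// ?mulr_ge0 ?(ltW mu_gt0) ?(ltW C_gt0).
Qed.

(** The term [t = 1] equals [C / mu], which is the source of [4^-1]. Each of the [n] later terms is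
    at most [4 * C / mu * (2 / (k + 2))]. *)
Lemma phase_error_sum k n :
  \sum_(1 <= t < n.+2) t%:R / c k t <= 4 * C / mu * (4^-1 + 2 * n%:R / (k%:R + 2)).
Proof.
have cE t : c k t.+1 = mu / (4 * C) * (2 * (t%:R + 2) + k%:R * t%:R).
  by rewrite /c -!natr1; field; rewrite gt_eqF.
elim: n => [|n IH].
  rewrite big_nat1 cE ?mulr0 ?mul0r ?add0r ?addr0 le_eqVlt; apply/orP; left.
  by apply/eqP; field; rewrite !gt_eqF.
rewrite big_nat_recr//=.
have k2 : 0 < k%:R + 2 :> R by rewrite ltr_wpDl.
have : n.+2%:R / c k n.+2 <= 4 * C / mu * (2 / (k%:R + 2)).
  rewrite ler_pdivrMr ?phase_weight_gt0// cE.
  rewrite [leRHS](_ : _ = 2 / (k%:R + 2) * (2 * (n.+1%:R + 2) + k%:R * n.+1%:R)); last first.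
    by field; rewrite !gt_eqF.
  rewrite mulrAC ler_pdivlMr// -!natr1.
  have : 0 <= k%:R * n%:R :> R by rewrite mulr_ge0.
  have : 0 <= n%:R :> R by [].
  nra.
have -> : 4 * C / mu * (4^-1 + 2 * n.+1%:R / (k%:R + 2)) =
   4 * C / mu * (4^-1 + 2 * n%:R / (k%:R + 2)) + 4 * C / mu * (2 / (k%:R + 2)).
  by rewrite -natr1; field; rewrite !gt_eqF.
lra.
Qed.

Variable T : nat.
Hypothesis TE : T%:Z =
  Num.ceil (r * (2 * N%:R * C / mu) * Num.max (r * (8 * C / mu)) 1).

Let r_gt0 : 0 < r. Proof. by rewrite sqrtr_gt0 divr_gt0. Qed.
Let N_gt0 : 0 < N%:R :> R. Proof. by rewrite ltr0n (ltnW N_ge2). Qed.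

(** Each argument of [Num.max] gives one lower bound: the argument 1 the bound linear in [r], used
    against [1 / T ^ 2], and the other the bound quadratic in [r], used against [1 / T]. *)
Lemma inner_steps_ge :
  [/\ (0 < T)%N, r * (2 * N%:R * C / mu) <= T%:R &
      16 * r ^+ 2 * N%:R * C ^+ 2 / mu ^+ 2 <= T%:R].
Proof.
have hT : r * (2 * N%:R * C / mu) * Num.max (r * (8 * C / mu)) 1 <= T%:R.
  by rewrite -[T%:R]/(T%:Z%:~R) TE; exact: ceil_ge.
have p0 : 0 < r * (2 * N%:R * C / mu) by rewrite mulr_gt0// divr_gt0// !mulr_gt0.
have h1 : r * (2 * N%:R * C / mu) <= T%:R.
  apply: le_trans hT; rewrite -[leLHS]mulr1 ler_pM2l//.
  by rewrite le_max lexx orbT.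
split=> //; first by rewrite -(ltr0n R) (lt_le_trans p0).
apply: le_trans hT; apply: (@le_trans _ _ (r * (2 * N%:R * C / mu) * (r * (8 * C / mu)))).
  by rewrite le_eqVlt; apply/orP; left; apply/eqP; field; rewrite gt_eqF.
by rewrite ler_pM2l// le_max lexx.
Qed.

(** Each phase costs at most [B]. Over [N] phases the [1 / T] part sums to at most [mu * D / C] and
    the [1 / T ^ 2] part to at most three quarters of it. *)
Lemma total_error_le :
  \sum_(1 <= k < N.+1) k.+1%:R *
    ((\sum_(1 <= t < T.+1) t%:R)^-1 * \sum_(1 <= t < T.+1) t%:R * (A / c k t))
  <= 2 * mu * D / C.
Proof.
have [T0 T1 T2] := inner_steps_ge.
have T0R : 0 < T%:R :> R by rewrite ltr0n.
have AE : A = r ^+ 2 * D by rewrite sqr_sqrtr ?divfK ?gt_eqF// divr_ge0// ltW.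
pose B := A * (4 * C / mu) * (3 * N%:R / (4 * T%:R ^+ 2) + 4 / T%:R).
apply: (@le_trans _ _ (\sum_(1 <= k < N.+1) B)).
  rewrite big_nat [leRHS]big_nat; apply: ler_sum => k /andP[k1 kN].
  have -> : \sum_(1 <= t < T.+1) t%:R * (A / c k t) =
      A * \sum_(1 <= t < T.+1) t%:R / c k t.
    by rewrite mulr_sumr; apply: eq_bigr => t _; rewrite mulrCA.
  rewrite inner_weights_sum.
  have [n Tn] : exists n, T = n.+1 by exists T.-1; rewrite prednK.
  rewrite /B Tn; rewrite Tn in T0R; clear T1 T2 B.
  have k2 : 0 < k%:R + 2 :> R by rewrite ltr_wpDl.
  (* From [k <= N] and [N >= 2]. *)
  have hk : k.+1%:R <= 3 / 2 * N%:R :> R.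
    have : k.+1%:R <= N.+1%:R :> R by rewrite ler_nat.
    have : 2 <= N%:R :> R by rewrite ler_nat.
    by rewrite -[k.+1%:R]natr1 -[N.+1%:R]natr1; lra.
  have n0 : 0 <= n%:R :> R by [].
  have T1 : 0 < n.+1%:R * (n.+1%:R + 1) / 2 :> R.
    by rewrite divr_gt0// mulr_gt0// ltr_wpDl.
  have h := phase_error_sum k n.
  apply: (@le_trans _ _ (k.+1%:R * ((n.+1%:R * (n.+1%:R + 1) / 2)^-1 *
     (A * (4 * C / mu * (4^-1 + 2 * n%:R / (k%:R + 2))))))).
    apply: ler_wpM2l => //; apply: ler_wpM2l; first by rewrite invr_ge0 ltW.
    by apply: ler_wpM2l => //; exact: ltW.
  have -> : k.+1%:R * ((n.+1%:R * (n.+1%:R + 1) / 2)^-1 *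
     (A * (4 * C / mu * (4^-1 + 2 * n%:R / (k%:R + 2))))) =
    A * (4 * C / mu) * (k.+1%:R / (2 * (n.+1%:R * (n.+1%:R + 1)))
      + 4 * (k.+1%:R / (k%:R + 2)) * (n%:R / (n.+1%:R + 1)) / n.+1%:R).
    by rewrite -!natr1; field; rewrite !gt_eqF ?ltr_wpDl//.
  apply: ler_wpM2l; first by rewrite !mulr_ge0 ?invr_ge0// ltW.
  apply: lerD.
    rewrite ler_pdivrMr ?mulr_gt0 ?ltr_wpDl// mulrAC ler_pdivlMr ?mulr_gt0 ?exprn_gt0//.
    apply: (@le_trans _ _ (3 / 2 * N%:R * (4 * n.+1%:R ^+ 2))).
      by rewrite ler_wpM2r// mulr_ge0 ?sqr_ge0.
    rewrite -subr_ge0 (_ : _ - _ = 6 * N%:R * n.+1%:R); last by field.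
    by rewrite !mulr_ge0.
  rewrite ler_wpM2r ?invr_ge0// -[leRHS]mulr1 ler_pM ?mulr_ge0 ?invr_ge0 ?addr_ge0//.
    rewrite -[leRHS]mulr1 ler_pM2l// ler_pdivrMr// mul1r -[k.+1%:R]natr1; lra.
  by rewrite ler_pdivrMr ?ltr_wpDl// mul1r -[n.+1%:R]natr1; lra.
rewrite sumr_const_nat subn1 /= -[_ *+ N]mulr_natl.
have h1 : (4 * N%:R * C / mu * 4 * A) / T%:R <= mu * D / C.
  rewrite ler_pdivrMr//.
  have -> : 4 * N%:R * C / mu * 4 * A =
     mu * D / C * (16 * r ^+ 2 * N%:R * C ^+ 2 / mu ^+ 2).
    by rewrite AE; field; rewrite !gt_eqF.
  by rewrite ler_pM2l// !mulr_gt0 ?invr_gt0.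
have h2 : (3 * N%:R ^+ 2 * C / mu * A) / T%:R ^+ 2 <= 3 / 4 * (mu * D / C).
  rewrite ler_pdivrMr ?exprn_gt0//.
  have -> : 3 * N%:R ^+ 2 * C / mu * A =
     3 / 4 * (mu * D / C) * (r * (2 * N%:R * C / mu)) ^+ 2.
    by rewrite AE; field; rewrite !gt_eqF.
  rewrite ler_pM2l ?mulr_gt0 ?invr_gt0//.
  rewrite ler_sqr ?nnegrE// mulr_ge0// ?divr_ge0 ?mulr_ge0// ltW//.
have h3 : 0 < mu * D / C by rewrite divr_gt0// mulr_gt0.
have -> : N%:R * B = (4 * N%:R * C / mu * 4 * A) / T%:R
   + (3 * N%:R ^+ 2 * C / mu * A) / T%:R ^+ 2.
  by rewrite /B; field; rewrite !gt_eqF.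
lra.
Qed.

End budget.

(** * Measurability and expectation *)

Section measurability_in_coordinates.
Variables (R : realType) (p q : nat).
Variables (disp : measure_display) (T : measurableType disp).

(** Measurability is tracked by entries, so that linear operations reduce to real-valued functions;
    [coord_measurable_borelV] recovers Borel measurability of rows. *)
Definition coord_measurable (p q : nat) (g : T -> 'M[R]_(p, q)) :=
  forall i j, measurable_fun setT (fun x => g x i j).

Variable g : T -> 'M[R]_(p, q).
Hypothesis mg : coord_measurable g.

Lemma measurable_preimage_ball c (r : R) : 0 < r ->
  measurable [set x | `|g x - c| < r].
Proof.
move=> r0.
have -> : [set x | `|g x - c| < r] =
    \bigcap_(ij in [set: 'I_p * 'I_q]) [set x | `|g x ij.1 ij.2 - c ij.1 ij.2| < r].
  apply/seteqP; split => x /=.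
    move=> gr [i j] _ /=; apply: le_lt_trans gr.
    by have := ler_mx_norm_coord (g x - c) i j; rewrite !mxE.
  by move=> gr; apply: mx_norm_lt => // i j; rewrite !mxE; exact: (gr (i, j)).
apply: fin_bigcap_measurable => [|[i j] _ /=].
  exact: finite_finset.
have mgc : measurable_fun setT (fun x => `|g x i j - c i j|).
  by apply: measurableT_comp => //; exact: measurable_funB.
have := mgc measurableT _ (measurable_itv `]-oo, r[); rewrite setTI.
by congr measurable; apply/seteqP; split => x /=; rewrite in_itv.
Qed.

(** An open set is the countable union of the balls with rational centre and radius [1 / (n + 1)]
    that it contains. *)
Lemma measurable_preimage_open (O : set 'M[R]_(p, q)) :
  open O -> measurable (g @^-1` O).
Proof.
move=> oO.
pose rad n : R := n.+1%:R^-1.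
pose cen (c : 'M[rat]_(p, q)) : 'M[R]_(p, q) := map_mx ratr c.
pose B (cn : 'M[rat]_(p, q) * nat) : set T :=
  if `[< forall v : 'M[R]_(p, q), `|v - cen cn.1| < rad cn.2 -> O v >]
  then [set x | `|g x - cen cn.1| < rad cn.2] else set0.
have -> : g @^-1` O = \bigcup_cn B cn.
  apply/seteqP; split => x /=; last first.
    move=> [[c n] _]; rewrite /B /=; by case: asboolP => // H; exact: H.
  move=> Ogx; have : nbhs (g x) O by exact: open_nbhs_nbhs.
  move=> /nbhs_ballP[e /= e0 He].
  (* With a centre closer than [rad n] to [g x], the ball of radius [rad n] stays within distance
     [e] of [g x]. *)
  have [n en] : exists n, rad n < e / 2.
    have [n _ /(_ n (leqnn n))] := near_infty_natSinv_lt (PosNum (divr_gt0 e0 (ltr0Sn R 1))).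
    by exists n.
  have rn : 0 < rad n by rewrite invr_gt0.
  have H i j : exists r : rat, `|g x i j - ratr r| < rad n.
    have hlt : g x i j - rad n < g x i j + rad n by lra.
    have [r] := rat_in_itvoo hlt.
    rewrite in_itv /= => /andP[r1 r2]; exists r.
    by rewrite ltr_norml; apply/andP; split; lra.
  pose c : 'M[rat]_(p, q) := \matrix_(i, j) xget 0 [set r | `|g x i j - ratr r| < rad n].
  have gc : `|g x - cen c| < rad n.
    apply: mx_norm_lt => // i j; rewrite !mxE.
    by case: xgetP => [r -> //|/(_ _)] /=; have [r hr] := H i j; move=> /(_ r).
  exists (c, n) => //; rewrite /B /=; case: asboolP => // -[] v vc.
  apply: He; rewrite -ball_normE /=.
  have -> : g x - v = (g x - cen c) - (v - cen c) by rewrite opprB addrA subrK.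
  by rewrite (le_lt_trans (ler_normB _ _))//; lra.
apply: countable_bigcupT_measurable; first exact: countableP.
move=> [c n].
rewrite /B; case: ifP => _; last exact: measurable0.
by apply: measurable_preimage_ball; rewrite invr_gt0.
Qed.

(** For functions that depend continuously on [g] without a formula, such as minimizers: the
    preimage of a ray is the preimage under [g] of a union of balls around values of [g], which is
    open. *)
Lemma measurable_factor (phi : T -> R) :
  (forall x (eps : R), 0 < eps -> exists2 del : R, 0 < del &
     forall x', `|g x' - g x| < del -> `|phi x' - phi x| < eps) ->
  measurable_fun setT phi.
Proof.
move=> H; apply: (measurability _ (RGenOInfty.measurableE R)) => _ [_ [a ->] <-].
rewrite setTI.
pose O : set 'M[R]_(p, q) := \bigcup_(xd in [set xd : T * R | 0 < xd.2 /\
    forall x', `|g x' - g xd.1| < xd.2 -> a < phi x']) ball (g xd.1) xd.2.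
have -> : phi @^-1` `]a, +oo[ = g @^-1` O.
  apply/seteqP; split => x /=.
    rewrite in_itv /= andbT => ax.
    have [|del del0 Hd] := H x (phi x - a); first by rewrite subr_gt0.
    exists (x, del) => /=; last exact: ballxx.
    split=> // x' /Hd; rewrite ltr_norml => /andP[h _]; lra.
  move=> [[x' del] /= [del0 Hd]]; rewrite -ball_normE /= distrC => /Hd.
  by rewrite in_itv /= andbT.
apply: measurable_preimage_open; apply: bigcup_open => -[x del] /= [del0 _].
exact: ball_open.
Qed.

End measurability_in_coordinates.

Section borelV_theory.
Variables (R : realType) (d : nat).

Lemma borelV_coord_measurable (disp : measure_display) (T : measurableType disp)
    (D : set T) (g : T -> borelV R d) :
  measurable_fun D g -> forall j, measurable_fun D (fun x => g x 0 j).
Proof.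
move=> mg j; pose h (v : borelV R d) : R := v 0 j.
suff mh : measurable_fun setT h by exact: measurableT_comp mh mg.
apply: (measurability _ (RGenOInfty.measurableE R)) => _ [_ [a ->] <-].
rewrite setTI; apply: sub_sigma_algebra.
by apply: open_comp => [v _|]; [exact: (@coord_continuous R 1 d 0 j)|exact: rray_open].
Qed.

Lemma coord_measurable_borelV (disp : measure_display) (T : measurableType disp)
    (g : T -> 'rV[R]_d) :
  coord_measurable g -> measurable_fun setT (g : T -> borelV R d).
Proof.
move=> mg; apply: (@measurability _ _ T (borelV R d) setT g (@open 'rV[R]_d)) => //.
move=> _ [U oU <-]; rewrite setTI; exact: measurable_preimage_open.
Qed.

Lemma closed_borelV_measurable (X : set 'rV[R]_d) :
  closed X -> measurable (X : set (borelV R d)).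
Proof.
move=> cX; rewrite -[X]setCK; apply: measurableC.
by apply: sub_sigma_algebra; exact: closed_openC.
Qed.

End borelV_theory.

(** * Calculus of upper bounds on means *)

Section expectation_bounds.
Variables (disp : measure_display) (T : measurableType disp) (R : realType).
Variable P : probability T R.
Implicit Types X Y : T -> R.

(* No measurability is needed: the integral of a nonnegative function is defined
   as a supremum over the simple functions below it. *)
Lemma integral_mono (f g : T -> \bar R) : (forall x, f x <= g x)%E ->
  (\int[P]_x f x <= \int[P]_x g x)%E.
Proof.
move=> fg; rewrite /integral; apply: leeB.
  apply: ereal_sup_le; apply: image_subset => h /= hf x.
  apply: le_trans (hf x) _; rewrite !funeposE !patchE !in_setT.
  by rewrite ge_max le_max fg le_max lexx orbT.
apply: ereal_sup_le; apply: image_subset => h /= hg x.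
apply: le_trans (hg x) _; rewrite !funenegE !patchE !in_setT.
by rewrite ge_max le_max leeN2 fg le_max lexx orbT.
Qed.

Lemma expectation_mono X Y : (forall x, X x <= Y x) -> ('E_P[X] <= 'E_P[Y])%E.
Proof.
by move=> XY; rewrite unlock; apply: integral_mono => x; rewrite lee_fin.
Qed.

(** Integrability is bundled with the bound because the integral is split over sums of integrable
    functions. *)
Definition mean_le X (c : R) : Prop :=
  P.-integrable setT (EFin \o X) /\ ('E_P[X] <= c%:E)%E.

Lemma mean_le_cst c : mean_le (cst c) c.
Proof.
split; last by rewrite expectation_cst.
exact: finite_measure_integrable_cst.
Qed.

Lemma mean_leD X Y a b : mean_le X a -> mean_le Y b ->
  mean_le (fun x => X x + Y x) (a + b).
Proof.
move=> [iX lX] [iY lY]; have iXY := integrableD measurableT iX iY.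
split; first by [].
rewrite unlock; under eq_integral do rewrite EFinD.
by rewrite integralD// EFinD; move: lX lY; rewrite unlock; exact: leeD.
Qed.

Lemma mean_leZ X a k : 0 <= k -> mean_le X a -> mean_le (fun x => k * X x) (k * a).
Proof.
move=> k0 [iX lX]; split; first exact: (integrableZl measurableT k iX).
rewrite unlock; under eq_integral do rewrite EFinM.
rewrite integralZl// EFinM; apply: lee_wpmul2l; first by rewrite lee_fin.
by move: lX; rewrite unlock.
Qed.

Lemma mean_leZr X a k : 0 <= k -> mean_le X a -> mean_le (fun x => X x * k) (a * k).
Proof.
by move=> k0 /(mean_leZ k0); rewrite mulrC; under eq_fun do rewrite mulrC.
Qed.

Lemma mean_le_sum (I : eqType) (r : seq I) (X : I -> T -> R) (a : I -> R) :
  (forall i, i \in r -> mean_le (X i) (a i)) ->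
  mean_le (fun x => \sum_(i <- r) X i x) (\sum_(i <- r) a i).
Proof.
elim: r => [_|i r IH H].
  rewrite (_ : (fun _ => _) = cst 0); last by apply/funext => x; rewrite big_nil.
  by rewrite big_nil; exact: mean_le_cst.
rewrite big_cons (_ : (fun _ => _) = (fun x => X i x + \sum_(j <- r) X j x)).
  apply: mean_leD; first by apply: H; rewrite mem_head.
  by apply: IH => j jr; apply: H; rewrite in_cons jr orbT.
by apply/funext => x; rewrite big_cons.
Qed.

Lemma mean_le_weaken X a b : a <= b -> mean_le X a -> mean_le X b.
Proof. by move=> ab [iX lX]; split => //; apply: le_trans lX _; rewrite lee_fin. Qed.

Lemma mean_le_integrable X c : measurable_fun setT X -> (forall x, 0 <= X x) ->
  ('E_P[X] <= c%:E)%E -> mean_le X c.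
Proof.
move=> mX X0 lX; split => //; apply/integrableP; split.
  exact/measurable_EFinP.
have -> : (\int[P]_x `|(EFin \o X) x| = \int[P]_x (X x)%:E)%E.
  by apply: eq_integral => x _; rewrite /= ger0_norm.
by move: lX; rewrite unlock => /le_lt_trans; apply; rewrite ltry.
Qed.

(** A difference of extended reals is finite only if both terms are. A finite mean thus forces the
    positive and the negative part to have finite integrals, so unbiasedness makes the oracle
    coordinates integrable. *)
Lemma expectation_integrable X c : measurable_fun setT X ->
  ('E_P[X] = c%:E)%E -> P.-integrable setT (EFin \o X).
Proof.
move=> mX; rewrite unlock integralE => XE.
have mX' : measurable_fun setT (EFin \o X) by exact/measurable_EFinP.
have : ((\int[P]_x (fun x => (X x)%:E)^\+ x)%E \is a fin_num) /\
   ((\int[P]_x (fun x => (X x)%:E)^\- x)%E \is a fin_num).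
  by move: XE; do 2!case: (integral _ _ _) => [?||].
move=> [fp fn]; apply/integrableP; split => //.
under eq_integral do rewrite -/((abse \o (EFin \o X)) _) fune_abse.
rewrite ge0_integralD//; [|exact: measurable_funepos|exact: measurable_funeneg].
by rewrite lte_add_pinfty// ltey_eq ?fp ?fn.
Qed.

Lemma mean_le_centered X a c : measurable_fun setT X -> ('E_P[X] = a%:E)%E ->
  mean_le (fun x => c * (X x - a)) 0.
Proof.
move=> mX XE; have iX := expectation_integrable mX XE.
have ia : P.-integrable setT (EFin \o cst a) by exact: finite_measure_integrable_cst.
have iB := integrableB measurableT iX ia.
split; first exact: (integrableZl measurableT c iB).
rewrite unlock; under eq_integral do rewrite EFinM.
rewrite integralZl//=.
rewrite [X in (_ * X)%E](_ : _ = 0)%E ?mule0//.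
under eq_integral do rewrite EFinB.
rewrite integralB//= integral_cst//= probability_setT mule1.
by move: XE; rewrite unlock => ->; rewrite subee.
Qed.

End expectation_bounds.

(** * Independence as a product law, and Tonelli's theorem *)

Section independence.
Variables (d0 d1 d2 : measure_display) (T : measurableType d0).
Variables (T1 : measurableType d1) (T2 : measurableType d2) (R : realType).
Variables (P : probability T R) (Y : T -> T1) (Z : T -> T2).
Hypotheses (mY : measurable_fun setT Y) (mZ : measurable_fun setT Z).
Hypothesis YZ : independent P Y Z.

Let YV : {RV P >-> T1} := mfun_Sub (mem_set mY).
Let ZV : {RV P >-> T2} := mfun_Sub (mem_set mZ).
Let mYZ : measurable_fun setT (fun x => (Y x, Z x)).
Proof. exact: measurable_fun_pair. Qed.
Let YZV : {RV P >-> (T1 * T2)%type} := mfun_Sub (mem_set mYZ).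

Let independent_law (A : set (T1 * T2)) : measurable A ->
  (distribution P YV \x distribution P ZV)%E A = distribution P YZV A.
Proof.
by move=> mA; apply: product_measure_unique => // B1 B2; exact: YZ.
Qed.

(** This replaces conditioning on [Y]: the joint law is the product of the marginals, since they
    agree on rectangles, and Tonelli freezes [Y] in the inner integral. *)
Lemma independent_integral_ge0 (phi : T1 * T2 -> \bar R) :
  measurable_fun setT phi -> (forall z, 0 <= phi z)%E ->
  (\int[P]_x phi (Y x, Z x) = \int[P]_x \int[P]_x' phi (Y x, Z x'))%E.
Proof.
move=> mphi phi0.
transitivity (\int[distribution P YZV]_z phi z)%E.
  by rewrite ge0_integral_distribution.
rewrite -(eq_measure_integral _ (fun A mA _ => independent_law mA)).
rewrite fubini_tonelli1//= ge0_integral_distribution//.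
- apply: eq_integral => x _; rewrite /= /fubini_F ge0_integral_distribution//.
  by apply: measurableT_comp => //; exact: pair1_measurable.
- exact: measurable_fun_fubini_tonelli_F.
- by move=> y; exact: integral_ge0.
Qed.

End independence.

(** * Moments of the oracle error at a random search point *)

Section oracle_noise.
Variables (R : realType) (d : nat) (X : set 'rV[R]_d).
Hypothesis X_closed : closed X.
Variable nu : 'rV[R]_d -> R.
Hypothesis nuP : is_norm nu.
Variables (d0 d2 : measure_display) (T : measurableType d0).
Variables (T2 : measurableType d2) (P : probability T R).
Variables (Y : T -> 'rV[R]_d) (Z : {RV P >-> T2}).
Hypotheses (mY : coord_measurable Y) (XY : forall x, X (Y x)).
Hypothesis YZ : independent P (Y : T -> borelV R d) Z.
Variables (G : 'rV[R]_d -> T2 -> 'rV[R]_d) (f' : 'rV[R]_d -> 'rV[R]_d).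
Hypothesis mG : measurable_fun ((X : set (borelV R d)) `*` [set: T2])
  (fun p : borelV R d * T2 => G p.1 p.2 : borelV R d).
Hypothesis G_unbiased : forall v j, X v ->
  ('E_P[fun x => (G v (Z x) 0 j)%R] = (f' v 0 j)%:E)%E.
Variable s : R.
Hypothesis G_variance : forall v, X v ->
  ('E_P[fun x => (dual_norm nu (G v (Z x) - f' v) ^+ 2)%R] <= s%:E)%E.

Let mYb : measurable_fun setT (Y : T -> borelV R d).
Proof. exact: coord_measurable_borelV. Qed.

Let A : set (borelV R d * T2) := (X : set (borelV R d)) `*` [set: T2].
Let mA : measurable A.
Proof. by apply: measurableX => //; exact: closed_borelV_measurable. Qed.

(** The oracle is measurable on [A] only; extended by a default value it becomes measurable
    everywhere. *)
Let Gc j : borelV R d * T2 -> R := (fun p => G p.1 p.2 0 j) \_ A.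
Let mGc j : measurable_fun setT (Gc j).
Proof. exact: (measurable_restrictT _ mA).1 (borelV_coord_measurable mG j). Qed.

Let GcE v t j : X v -> Gc j (v, t) = G v t 0 j.
Proof. by move=> Xv; rewrite /Gc patchE mem_set. Qed.

Let mpair : measurable_fun setT (fun p : borelV R d * T => (p.1, Z p.2)).
Proof.
by apply: measurable_fun_pair => //; apply: measurableT_comp.
Qed.

(* By unbiasedness [F j] is the j-th coordinate of [f'] on [X]; being a partial
   integral of [Gc j] it is measurable, whereas nothing is assumed on [f']. *)
Let F j (v : borelV R d) : \bar R := (\int[P]_x (Gc j (v, Z x))%:E)%E.

Let mF j : measurable_fun setT (F j).
Proof.
rewrite (_ : F j = (fun v => fubini_F P (fun p : borelV R d * T =>
   (EFin \o Gc j)^\+ (p.1, Z p.2)) v - fubini_F P (fun p : borelV R d * T =>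
   (EFin \o Gc j)^\- (p.1, Z p.2)) v)%E); last first.
  apply/funext => v; rewrite /F integralE /fubini_F /=; congr (_ - _)%E.
    by apply: eq_integral => x _; rewrite !funeposE.
  by apply: eq_integral => x _; rewrite !funenegE.
have mE : measurable_fun setT (EFin \o Gc j) by exact/measurable_EFinP.
apply: emeasurable_funB; apply: measurable_fun_fubini_tonelli_F => //.
- by apply: (measurableT_comp _ mpair); exact: measurable_funepos.
- by apply: (measurableT_comp _ mpair); exact: measurable_funeneg.
Qed.

Let FE v j : X v -> F j v = (f' v 0 j)%:E.
Proof.
move=> Xv; rewrite -G_unbiased// unlock; apply: eq_integral => x _.
by rewrite GcE.
Qed.

(** A jointly measurable version of the oracle error, equal to it at points of [X]. *)
Let Dl (p : borelV R d * T2) : 'rV[R]_d := \row_j (Gc j p - fine (F j p.1)).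

Let mDl : coord_measurable Dl.
Proof.
move=> i j; rewrite (_ : (fun _ => _) = (fun p => Gc j p - fine (F j p.1))).
  apply: measurable_funB => //; apply: measurableT_comp => //.
  exact: (measurableT_comp (mF j) measurable_fst).
by apply/funext => p; rewrite mxE.
Qed.

Let DlE v t : X v -> Dl (v, t) = G v t - f' v.
Proof.
by move=> Xv; apply/matrixP => i j; rewrite !mxE GcE// FE//= ord1.
Qed.

Let phi2 p := dual_norm nu (Dl p) ^+ 2.
Let mphi2 : measurable_fun setT phi2.
Proof.
apply: measurable_funX; apply: (measurable_factor mDl) => p eps eps0.
have [c c0 cP] := dual_norm_lip nuP.
exists (eps / c); first by rewrite divr_gt0.
by move=> p'; rewrite ltr_pdivlMr// mulrC => /(le_lt_trans (cP _ _)).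
Qed.

Let mYZ : measurable_fun setT (fun x => (Y x : borelV R d, Z x)).
Proof. exact: measurable_fun_pair. Qed.

(** With the search point frozen, the variance bound applies to the inner integral at every value of
    [Y]. *)
Lemma noise_sqr : mean_le P (fun x => dual_norm nu (G (Y x) (Z x) - f' (Y x)) ^+ 2) s.
Proof.
have E x : dual_norm nu (G (Y x) (Z x) - f' (Y x)) ^+ 2 = phi2 (Y x, Z x).
  by rewrite /phi2 DlE.
apply: mean_le_integrable => [|x|]; [|exact: sqr_ge0|].
  rewrite (_ : (fun _ => _) = phi2 \o (fun x => (Y x : borelV R d, Z x))).
    exact: measurableT_comp.
  by apply/funext => x; rewrite E.
rewrite unlock; under eq_integral do rewrite E.
rewrite (independent_integral_ge0 mYb (measurable_funPT Z) YZ (phi := EFin \o phi2)).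
- apply: (@le_trans _ _ (\int[P]_x (cst s%:E x))%E).
    apply: integral_mono => x; apply: le_trans (G_variance (XY x)).
    by rewrite unlock; apply: integral_mono => t; rewrite /= /phi2 DlE.
  by have [_] := mean_le_cst P s; rewrite unlock.
- exact/measurable_EFinP.
- by move=> p; rewrite lee_fin sqr_ge0.
Qed.

Variables (z : 'rV[R]_d) (b : R).
Hypothesis b_ge : forall v, X v -> nu (z - v) <= b.

(** Tonelli is applied to the positive and the negative part separately. For a frozen search point
    [v] the error is centred and [z - v] is constant, so the inner integrals compare. *)
Lemma noise_inner : mean_le P (fun x => inner (G (Y x) (Z x) - f' (Y x)) (z - Y x)) 0.
Proof.
pose phi1 (p : borelV R d * T2) := inner (Dl p) (z - p.1).
have mphi1 : measurable_fun setT phi1.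
  rewrite /phi1 /inner; apply: measurable_sum => i; apply: measurable_sum => j.
  apply: measurable_funM; first exact: mDl.
  rewrite (_ : (fun _ => _) = (fun p : borelV R d * T2 => z i j - p.1 0 j)).
    apply: measurable_funB => //.
    by apply: borelV_coord_measurable; exact: measurable_fst.
  by apply/funext => p; rewrite !mxE [i]ord1.
have mphi1E : measurable_fun setT (EFin \o phi1) by exact/measurable_EFinP.
have E x : inner (G (Y x) (Z x) - f' (Y x)) (z - Y x) = phi1 (Y x, Z x).
  by rewrite /phi1 DlE.
(* A probability space has a point, and its search point lies in [X]. *)
have b0 : 0 <= b.
  have [x _] : [set: T] !=set0.
    apply/set0P; apply: contraT => /negPn/eqP T0.
    have := probability_setT P; rewrite T0 measure0 => /eqP.
    by rewrite eqe eq_sym oner_eq0.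
  exact: le_trans (norm_ge0 nuP _) (b_ge (XY x)).
have iphi : P.-integrable setT (EFin \o (fun x => phi1 (Y x, Z x))).
  (* The dominating function is [b * (dl ^+ 2 + 1)], since [dl <= dl ^+ 2 + 1]. *)
  have [i2 _] := mean_leZ b0 (mean_leD noise_sqr (mean_le_cst P 1)).
  apply: le_integrable i2 => //.
    exact/measurable_EFinP/(measurableT_comp mphi1).
  move=> x _; rewrite /= lee_fin -E [leRHS]ger0_norm; last first.
    by rewrite mulr_ge0 ?addr_ge0 ?sqr_ge0.
  set dl := dual_norm _ _.
  have dl0 : 0 <= dl := dual_norm_ge0 nuP _.
  have h : `|inner (G (Y x) (Z x) - f' (Y x)) (z - Y x)| <= dl * b.
    have nb := b_ge (XY x).
    rewrite ler_norml lerNl -innerNr; apply/andP; split.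
      apply: le_trans (ler_inner_dual nuP _ _) _.
      by rewrite (norm_opp nuP) ler_wpM2l.
    by apply: le_trans (ler_inner_dual nuP _ _) _; rewrite ler_wpM2l.
  apply: le_trans h _; rewrite mulrC ler_wpM2l//.
  by have := sqr_ge0 (dl - 1); nra.
split; first by rewrite (_ : (fun _ => _) = (fun x => phi1 (Y x, Z x)))//; apply/funext.
rewrite unlock (eq_integral (fun x => (phi1 (Y x, Z x))%:E)); last first.
  by move=> x _; rewrite E.
have H v : X v -> mean_le P (fun t => phi1 (v, Z t)) 0.
  move=> Xv.
  rewrite (_ : (fun _ => _) =
      (fun t => \sum_j (z - v) 0 j * (G v (Z t) 0 j - f' v 0 j))); last first.
    apply/funext => t; rewrite /phi1 DlE// /inner big_ord1.
    by apply: eq_bigr => j _; rewrite mulrC !mxE.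
  have := mean_le_sum (r := index_enum 'I_d)
    (X := fun j t => (z - v) 0 j * (G v (Z t) 0 j - f' v 0 j)) (a := fun=> 0) (P := P).
  rewrite big1//; apply => j _.
  apply: mean_le_centered; last exact: G_unbiased.
  rewrite (_ : (fun _ => _) = (fun t => Gc j (v, Z t))); last first.
    by apply/funext => t; rewrite GcE.
  apply: (measurableT_comp (mGc j)); exact: (measurable_fun_pair
    (measurable_cst (v : borelV R d)) (measurable_funPT Z)).
have mp : measurable_fun setT (EFin \o phi1)^\+%E by exact: measurable_funepos.
have mn : measurable_fun setT (EFin \o phi1)^\-%E by exact: measurable_funeneg.
have fp := integrable_pos_fin_num measurableT iphi.
have fn := integrable_neg_fin_num measurableT iphi.
(* Both parts have finite integrals, so the claim becomes an inequality between two nonnegative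
   integrals. *)
rewrite integralE leeBlDr// add0e.
have Ep : ((fun x => (phi1 (Y x, Z x))%:E)^\+ = fun x => (EFin \o phi1)^\+ (Y x, Z x))%E.
  by apply/funext => x; rewrite !funeposE.
have En : ((fun x => (phi1 (Y x, Z x))%:E)^\- = fun x => (EFin \o phi1)^\- (Y x, Z x))%E.
  by apply/funext => x; rewrite !funenegE.
rewrite Ep En !(independent_integral_ge0 mYb (measurable_funPT Z) YZ)//.
apply: integral_mono => x; have [ix] := H _ (XY x).
have fpx := integrable_pos_fin_num measurableT ix.
have fnx := integrable_neg_fin_num measurableT ix.
rewrite unlock integralE leeBlDr// add0e.
by congr (_ <= _)%E; apply: eq_integral => t _; rewrite ?funeposE ?funenegE.
Qed.

End oracle_noise.

(** * Runs of the method *)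

Section sdcs_sample_path.
Variables (R : realType) (m d : nat) (e : rel 'I_m).
Variables (X : 'I_m -> set 'rV[R]_d) (X_convex : forall i, convex_set (X i)).
Variables (nu : 'I_m -> 'rV[R]_d -> R) (nu_norm : forall i, is_norm (nu i)).
Variables mu M C : R.
Hypotheses (mu_gt0 : 0 < mu) (M_gt0 : 0 < M) (C_gt0 : 0 < C).
Variables (f : 'I_m -> 'rV[R]_d -> R) (f' : 'I_m -> 'rV[R]_d -> 'rV[R]_d).
Hypothesis f_bounds : forall i v z, X i v -> X i z ->
  mu / 2 * nu i (v - z) ^+ 2 <= f i v - f i z - inner (f' i z) (v - z)
  /\ f i v - f i z - inner (f' i z) (v - z) <= M * nu i (v - z).
Variables (w : 'I_m -> 'rV[R]_d -> R) (gw : 'I_m -> 'rV[R]_d -> 'rV[R]_d).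
Hypothesis w_C1 : forall i, C1_on (X i) (w i) (gw i).
Hypothesis w_strong : forall i v z, X i v -> X i z ->
  nu i (v - z) ^+ 2 <= inner (gw i v - gw i z) (v - z).
Hypothesis w_growth : forall i v z, X i v -> X i z ->
  bregman (w i) (gw i) v z <= C / 2 * nu i (v - z) ^+ 2.
Variables (alpha tau eta : nat -> R) (beta : nat -> nat -> R) (T : nat -> nat).
Variables (N : nat) (x0 y0 : 'M[R]_(m, d)) (hx0 : in_prod X x0).
Hypothesis T_gt0 : forall k, (0 < T k)%N.
Hypothesis etaE : forall k, eta k = k%:R * mu / (2 * C).
Hypothesis betaE : forall k t, beta k t =
  t.+1%:R * mu / (2 * eta k * C) + (t%:R - 1) / 2.
Variable g : 'I_m -> nat -> nat -> 'rV[R]_d -> 'rV[R]_d.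
Variables (x xh y : nat -> 'M[R]_(m, d)) (u : nat -> nat -> 'M[R]_(m, d)).
Hypothesis run : sdcs_path e X w gw alpha tau eta (fun t => t%:R) beta T N x0 y0
  g x xh y u.

Let c (k t : nat) : R :=
  t.+1%:R * mu / (2 * C) + k%:R * mu / (2 * C) * ((t%:R - 1) / 2).

Lemma in_prod_inner k t : (1 <= k <= N)%N -> (1 <= t <= T k)%N -> in_prod X (u k t).
Proof. by move=> kN tT i; have [] := sdcs_inner run i kN tT. Qed.

Lemma in_prod_primal k : (k <= N)%N -> in_prod X (x k).
Proof.
case: k => [_|k kN]; first by have [-> _ _] := sdcs_init run.
by rewrite (sdcs_last run)//; apply: in_prod_inner; rewrite // T_gt0 leqnn.
Qed.

Lemma in_prod_search_point k t : (1 <= k <= N)%N -> (t <= T k)%N -> in_prod X (u k t).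
Proof.
case: t => [|t] kN tT; last exact: in_prod_inner.
rewrite (sdcs_inner_init run)//; apply: in_prod_primal.
by case/andP: kN => _; apply: leq_trans; exact: leq_pred.
Qed.

Lemma row_average i k : (1 <= k <= N)%N -> row i (xh k) =
  (\sum_(1 <= t < (T k).+1) t%:R)^-1
    *: \sum_(1 <= t < (T k).+1) t%:R *: row i (u k t).
Proof.
move=> kN; rewrite (sdcs_avg run)// linearZ linear_sum.
by congr (_ *: _); apply: eq_bigr => t _; rewrite linearZ.
Qed.

Lemma in_prod_average k : (1 <= k <= N)%N -> in_prod X (xh k).
Proof.
move=> kN i; rewrite row_average//; apply: convex_comb => // t tT; split.
  by case: t tT => // t; rewrite ltr0n.
exact: in_prod_inner.
Qed.

Lemma prox_weightE k t : (1 <= k)%N -> eta k * beta k t = c k t.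
Proof.
move=> k1; have k0 : 0 < k%:R :> R by rewrite ltr0n.
by rewrite /c betaE etaE; field; rewrite !gt_eqF.
Qed.

Definition oracle_noise i k t :=
  g i k t (row i (u k t)) - f' i (row i (u k t)).

(** The square [(M + dl) ^+ 2 / (2 c)] of the inner loop is relaxed to [(M ^+ 2 + dl ^+ 2) / c], so
    that the noise enters by its second moment. The index [t.-1] is there because step [t] queries
    the oracle at the preceding iterate. *)
Definition phase_error (z : 'M[R]_(m, d)) k := \sum_i
  (\sum_(1 <= t < (T k).+1) t%:R)^-1 * \sum_(1 <= t < (T k).+1) t%:R *
   ((M ^+ 2 + dual_norm (nu i) (oracle_noise i k t.-1) ^+ 2) / c k t
    + inner (oracle_noise i k t.-1) (row i z - row i (u k t.-1))).

(** The inner-loop estimate of each agent, summed over the rows. This is the form of one phase that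
    the outer loop takes as hypothesis. *)
Lemma phase_inequality (z : 'M[R]_(m, d)) k : in_prod X z -> (1 <= k <= N)%N ->
  total_cost f (xh k) - total_cost f z + inner (bigL e (y k)) (xh k - z)
    + eta k * (bigV w gw (x k.-1) (xh k) - bigV w gw (x k.-1) z)
    + (eta k + mu / C) * bigV w gw (x k) z
  <= phase_error z k.
Proof.
move=> Xz kN; have /andP[k1 kN'] := kN.
have eta_gt0 : 0 < eta k.
  by rewrite etaE divr_gt0 ?mulr_gt0// ltr0n.
rewrite inner_rows /total_cost /bigV -!sumrB !mulr_sumr -!big_split/=.
apply: ler_sum => i _; rewrite linearB /=.
pose h t := g i k t (row i (u k t)).
have cE t : t.+1%:R * mu / (2 * C) + eta k * ((t%:R - 1) / 2) = c k t.
  by rewrite /c etaE.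
have H t : (1 <= t <= T k)%N -> is_argmin (X i) (fun v =>
    inner (row i (bigL e (y k)) + h t.-1) v
    + eta k * bregman (w i) (gw i) (row i (x k.-1)) v
    + (t.+1%:R * mu / (2 * C) + eta k * ((t%:R - 1) / 2))
      * bregman (w i) (gw i) (row i (u k t.-1)) v) (row i (u k t)).
  move=> tT; have := sdcs_inner run i kN tT.
  by rewrite /= prox_weightE// cE.
have Xu0 : X i (row i (u k 0%N)) by exact: in_prod_search_point.
have := inner_loop (@X_convex i) (nu_norm i) mu_gt0 C_gt0 eta_gt0
  (@f_bounds i) (w_C1 i) (@w_strong i) (@w_growth i) (Xz i) Xu0 (T_gt0 k) H
  (row_average i kN).
rewrite -(sdcs_last run)//.
move=> h1; apply: le_trans h1 _.
rewrite ler_pM2l; last first.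
  by rewrite invr_gt0 inner_weights_sum !mulr_gt0 ?ltr_wpDl ?ltr0n.
rewrite [leLHS]big_nat [leRHS]big_nat; apply: ler_sum => -[|t]// /andP[_ tT].
apply: ler_wpM2l => //=; rewrite cE; apply: lerD => //.
have c0 := phase_weight_gt0 mu_gt0 C_gt0 k t; rewrite -/(c k t.+1) in c0.
rewrite ler_pdivrMr ?mulr_gt0// mulrCA divfK ?gt_eqF//.
set dl := dual_norm _ _; rewrite /oracle_noise -/(h t) -/dl.
by have := sqr_ge0 (M - dl); lra.
Qed.

End sdcs_sample_path.

(** * Measurability of the iterates *)

Section coord_measurable_closure.
Variables (R : realType) (disp : measure_display) (T : measurableType disp).

Lemma coord_measurable_cst (p q : nat) (a : 'M[R]_(p, q)) :
  coord_measurable (fun _ : T => a).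
Proof. by move=> i j; exact: measurable_cst. Qed.

Lemma coord_measurableD (p q : nat) (g h : T -> 'M[R]_(p, q)) :
  coord_measurable g -> coord_measurable h ->
  coord_measurable (fun x => g x + h x).
Proof.
move=> mg mh i j; rewrite (_ : (fun _ => _) = (fun x => g x i j + h x i j)).
  exact: measurable_funD.
by apply/funext => x; rewrite mxE.
Qed.

Lemma coord_measurableZ (p q : nat) (a : R) (g : T -> 'M[R]_(p, q)) :
  coord_measurable g -> coord_measurable (fun x => a *: g x).
Proof.
move=> mg i j; rewrite (_ : (fun _ => _) = (fun x => a * g x i j)).
  by apply: measurable_funM => //; exact: measurable_cst.
by apply/funext => x; rewrite mxE.
Qed.

Lemma coord_measurableB (p q : nat) (g h : T -> 'M[R]_(p, q)) :
  coord_measurable g -> coord_measurable h ->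
  coord_measurable (fun x => g x - h x).
Proof.
move=> mg mh; under eq_fun do rewrite -scaleN1r.
by apply: coord_measurableD => //; exact: coord_measurableZ.
Qed.

Lemma coord_measurable_sum (p q : nat) (I : eqType) (r : seq I)
    (g : I -> T -> 'M[R]_(p, q)) :
  (forall i, i \in r -> coord_measurable (g i)) ->
  coord_measurable (fun x => \sum_(i <- r) g i x).
Proof.
elim: r => [_|k r IH H].
  by under eq_fun do rewrite big_nil; exact: coord_measurable_cst.
under eq_fun do rewrite big_cons.
apply: coord_measurableD; first by apply: H; rewrite mem_head.
by apply: IH => i ir; apply: H; rewrite in_cons ir orbT.
Qed.

Lemma coord_measurable_bigL (p q : nat) (e : rel 'I_p) (g : T -> 'M[R]_(p, q)) :
  coord_measurable g -> coord_measurable (fun x => bigL e (g x)).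
Proof.
move=> mg i j.
rewrite (_ : (fun _ => _) = (fun x => \sum_k laplacian R e i k * g x k j)).
  apply: measurable_sum => k.
  by apply: measurable_funM; [exact: measurable_cst|exact: mg].
by apply/funext => x; rewrite bigLE mxE.
Qed.

Lemma coord_measurable_row (p q : nat) (g : T -> 'M[R]_(p, q)) :
  coord_measurable g <-> forall i, coord_measurable (fun x => row i (g x)).
Proof.
split=> [mg i ? j|mg i j].
  by under eq_fun do rewrite mxE; exact: mg.
by have := mg i 0 j; under eq_fun do rewrite mxE.
Qed.

End coord_measurable_closure.

Section prox_measurability.
Variables (R : realType) (d : nat) (X : set 'rV[R]_d) (X_convex : convex_set X).
Variables (w : 'rV[R]_d -> R) (gw : 'rV[R]_d -> 'rV[R]_d).
Hypothesis w_C1 : C1_on X w gw.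
Variable nu : 'rV[R]_d -> R.
Hypothesis nuP : is_norm nu.
Hypothesis w_strong : forall v z, X v -> X z ->
  nu (v - z) ^+ 2 <= inner (gw v - gw z) (v - z).
Variables (disp : measure_display) (T : measurableType disp).

Lemma gradient_measurable (v : T -> 'rV[R]_d) :
  coord_measurable v -> (forall x, X (v x)) -> coord_measurable (fun x => gw (v x)).
Proof.
move=> mv Xv i j; apply: (measurable_factor mv) => x eps eps0.
have [del del0 H] := C1_gradient_eps w_C1 (Xv x) eps0.
exists del => // x' /(H _ (Xv x')); apply: le_lt_trans.
by have := ler_mx_norm_coord (gw (v x') - gw (v x)) i j; rewrite !mxE.
Qed.

(** The Lipschitz estimate [prox_stability] is the modulus of continuity that [measurable_factor]
    asks for. *)
Lemma argmin_measurable (kap : R) (q v : T -> 'rV[R]_d) : 0 < kap ->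
  coord_measurable q ->
  (forall x, is_argmin X (fun z => inner (q x) z + kap * w z) (v x)) ->
  coord_measurable v.
Proof.
move=> kap0 mq vmin i j; apply: (measurable_factor mq) => x eps eps0.
have [K K0 HK] := prox_stability X_convex w_C1 nuP w_strong kap0.
exists (eps / K) => [|x']; first by rewrite divr_gt0.
rewrite ltr_pdivlMr// mulrC; apply: le_lt_trans.
apply: le_trans (HK _ _ _ _ (vmin x') (vmin x)).
by have := ler_mx_norm_coord (v x' - v x) i j; rewrite !mxE.
Qed.

Lemma prox_measurable (eta kap : R) (p x v z : T -> 'rV[R]_d) :
  0 < eta + kap ->
  coord_measurable p -> coord_measurable x -> coord_measurable v ->
  (forall t, X (x t)) -> (forall t, X (v t)) ->
  (forall t, is_argmin X (fun u => inner (p t) u + eta * bregman w gw (x t) u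
                        + kap * bregman w gw (v t) u) (z t)) ->
  coord_measurable z.
Proof.
move=> ek mp mx mv Xx Xv H.
apply: (argmin_measurable (q := fun t => p t - eta *: gw (x t) - kap *: gw (v t)) ek).
  by do 2?apply: coord_measurableB => //; apply: coord_measurableZ;
    exact: gradient_measurable.
by move=> t; apply/prox_argminE.
Qed.

End prox_measurability.

Section sdcs_run_measurability.
Variables (R : realType) (m d : nat) (e : rel 'I_m).
Variables (X : 'I_m -> set 'rV[R]_d).
Hypotheses (X_closed : forall i, closed (X i)) (X_convex : forall i, convex_set (X i)).
Variables (nu : 'I_m -> 'rV[R]_d -> R) (nu_norm : forall i, is_norm (nu i)).
Variables mu C : R.
Hypotheses (mu_gt0 : 0 < mu) (C_gt0 : 0 < C).
Variables (w : 'I_m -> 'rV[R]_d -> R) (gw : 'I_m -> 'rV[R]_d -> 'rV[R]_d).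
Hypothesis w_C1 : forall i, C1_on (X i) (w i) (gw i).
Hypothesis w_strong : forall i v z, X i v -> X i z ->
  nu i (v - z) ^+ 2 <= inner (gw i v - gw i z) (v - z).
Variables (alpha tau eta : nat -> R) (beta : nat -> nat -> R) (T : nat -> nat).
Variables (N : nat) (x0 y0 : 'M[R]_(m, d)) (hx0 : in_prod X x0).
Hypothesis T_gt0 : forall k, (0 < T k)%N.
Hypothesis etaE : forall k, eta k = k%:R * mu / (2 * C).
Hypothesis betaE : forall k t, beta k t =
  t.+1%:R * mu / (2 * eta k * C) + (t%:R - 1) / 2.
Variables (dOmega : measure_display) (Omega : measurableType dOmega).
Variable P : probability Omega R.
Variables (dXi : 'I_m -> measure_display) (Xi : forall i, measurableType (dXi i)).
Variable xi : forall i, nat -> nat -> {RV P >-> Xi i}.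
Variable G : forall i, 'rV[R]_d -> Xi i -> 'rV[R]_d.
Hypothesis G_measurable : forall i,
  measurable_fun ((X i : set (borelV R d)) `*` [set: Xi i])
    (fun p : borelV R d * Xi i => G p.1 p.2 : borelV R d).
Variables (x xh y : Omega -> nat -> 'M[R]_(m, d)).
Variable u : Omega -> nat -> nat -> 'M[R]_(m, d).
Hypothesis run : forall om, sdcs_path e X w gw alpha tau eta (fun t => t%:R) beta
  T N x0 y0 (fun i k t v => G v (xi i k t om)) (x om) (xh om) (y om) (u om).

Lemma oracle_measurable i k t (v : Omega -> 'rV[R]_d) :
  coord_measurable v -> (forall om, X i (v om)) ->
  coord_measurable (fun om => G (v om) (xi i k t om)).
Proof.
move=> mv Xv i' j; rewrite ord1.
have mX : measurable ((X i : set (borelV R d)) `*` [set: Xi i]).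
  by apply: measurableX => //; exact: closed_borelV_measurable.
have mp : measurable_fun setT (fun om => (v om : borelV R d, xi i k t om)).
  by apply: measurable_fun_pair => //; exact: coord_measurable_borelV.
apply: (measurable_comp mX _ (borelV_coord_measurable (@G_measurable i) j) mp).
by move=> _ [om _ <-]; split => //; exact: Xv.
Qed.

Let in_prod_x om k : (k <= N)%N -> in_prod X (x om k).
Proof. exact: (in_prod_primal hx0 T_gt0 (run om)). Qed.

Let in_prod_u om k t : (1 <= k <= N)%N -> (t <= T k)%N -> in_prod X (u om k t).
Proof. exact: (in_prod_search_point hx0 T_gt0 (run om)). Qed.

Let inner_measurable k t : (1 <= k <= N)%N -> (t <= T k)%N ->
  coord_measurable (fun om => x om k.-1) -> coord_measurable (fun om => y om k) ->
  coord_measurable (fun om => u om k t).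
Proof.
move=> kN tT mx my; elim: t tT => [_|t IH tT].
  by under eq_fun do rewrite (sdcs_inner_init (run _))//.
have {}IH := IH (ltnW tT).
apply/coord_measurable_row => i.
have mrow (g : Omega -> 'M[R]_(m, d)) :
    coord_measurable g -> coord_measurable (fun om => row i (g om)).
  by move=> mg; apply: (coord_measurable_row _).1.
have Xu om : X i (row i (u om k t)) by apply: in_prod_u => //; exact: ltnW.
have Xx om : X i (row i (x om k.-1)).
  by apply: in_prod_x; case/andP: kN => _; apply: leq_trans; exact: leq_pred.
have /andP[k1 _] := kN.
apply: (prox_measurable (@X_convex i) (w_C1 i) (nu_norm i) (@w_strong i)
  (eta := eta k) (kap := eta k * beta k t.+1)
  (p := fun om => row i (bigL e (y om k)) + G (row i (u om k t)) (xi i k t om))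
  (x := fun om => row i (x om k.-1)) (v := fun om => row i (u om k t))) => //.
- rewrite (prox_weightE mu_gt0 C_gt0 etaE betaE)//.
  apply: addr_gt0; last exact: phase_weight_gt0.
  by rewrite etaE divr_gt0 ?mulr_gt0 ?ltr0n.
- apply: coord_measurableD; first by apply: mrow; exact: coord_measurable_bigL.
  by apply: oracle_measurable => //; exact: mrow.
- exact: mrow.
- exact: mrow.
- by move=> om; have := sdcs_inner (run om) i kN (t := t.+1) tT.
Qed.

Lemma outer_measurable k : (k <= N)%N ->
  [/\ coord_measurable (fun om => x om k), coord_measurable (fun om => xh om k)
    & coord_measurable (fun om => y om k)].
Proof.
(* All earlier phases are carried through the induction because the dual update reaches back to
   [x k.-2]. *)
suff H j : (j <= k)%N -> (k <= N)%N ->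
    [/\ coord_measurable (fun om => x om j), coord_measurable (fun om => xh om j)
    & coord_measurable (fun om => y om j)] by exact: H.
elim: k j => [|k IH] j.
  rewrite leqn0 => /eqP-> _.
  have -> : (fun om => x om 0%N) = (fun=> x0).
    by apply/funext => om; have [-> _ _] := sdcs_init (run om).
  have -> : (fun om => xh om 0%N) = (fun=> x0).
    by apply/funext => om; have [_ -> _] := sdcs_init (run om).
  have -> : (fun om => y om 0%N) = (fun=> y0).
    by apply/funext => om; have [_ _ ->] := sdcs_init (run om).
  by split; exact: coord_measurable_cst.
rewrite leq_eqVlt ltnS => /predU1P[->|jk] kN; last exact: IH (ltnW kN).
have k1 : (1 <= k.+1 <= N)%N by [].
have [mx mxh my] := IH k (leqnn k) (ltnW kN).
have [mx' _ _] := IH k.-1 (leq_pred k) (ltnW kN).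
have my1 : coord_measurable (fun om => y om k.+1).
  under eq_fun do rewrite (sdcs_dual (run _))//=.
  apply: coord_measurableD => //; apply/coord_measurableZ/coord_measurable_bigL.
  by apply: coord_measurableD => //; apply/coord_measurableZ/coord_measurableB.
have mu1 t : (t <= T k.+1)%N -> coord_measurable (fun om => u om k.+1 t).
  by move=> tT; exact: inner_measurable.
split=> //.
  by under eq_fun do rewrite (sdcs_last (run _))//; exact: mu1.
under eq_fun do rewrite (sdcs_avg (run _))//.
apply: coord_measurableZ; apply: coord_measurable_sum => t.
rewrite mem_index_iota ltnS => /andP[_ tT].
by apply: coord_measurableZ; exact: mu1.
Qed.

Lemma search_point_measurable k t : (1 <= k <= N)%N -> (t <= T k)%N ->
  coord_measurable (fun om => u om k t).
Proof.
move=> kN tT; have /andP[_ kN'] := kN.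
have [_ _ my] := outer_measurable kN'.
have [mx _ _] := outer_measurable (leq_trans (leq_pred k) kN').
exact: inner_measurable.
Qed.

Variables (M sigma : R) (f' : 'I_m -> 'rV[R]_d -> 'rV[R]_d).
Hypothesis G_unbiased : forall i k t v j, (1 <= k <= N)%N -> (t < T k)%N -> X i v ->
  ('E_P[fun om => (G v (xi i k t om) 0 j)%R] = (f' i v 0 j)%:E)%E.
Hypothesis G_variance : forall i k t v, (1 <= k <= N)%N -> (t < T k)%N -> X i v ->
  ('E_P[fun om => (dual_norm (nu i) (G v (xi i k t om) - f' i v) ^+ 2)%R]
     <= (sigma ^+ 2)%:E)%E.
Hypothesis xi_indep : forall i k t, (1 <= k <= N)%N -> (t < T k)%N ->
  independent P (fun om => row i (u om k t) : borelV R d) (xi i k t).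
Variables (z : 'M[R]_(m, d)) (b : 'I_m -> R).
Hypothesis b_ge : forall i v, X i v -> nu i (row i z - v) <= b i.

(** In every inner step of every agent the second moment contributes at most [sigma ^+ 2] and the
    inner-product term has mean at most 0. The sum over agents gives the factor [m]. *)
Lemma phase_error_mean k : (1 <= k <= N)%N ->
  mean_le P (fun om => phase_error nu mu M C f' T
               (fun i k t v => G v (xi i k t om)) (u om) z k)
    ((\sum_(1 <= t < (T k).+1) t%:R)^-1 * \sum_(1 <= t < (T k).+1) t%:R *
      (m%:R * (M ^+ 2 + sigma ^+ 2) /
       (t.+1%:R * mu / (2 * C) + k%:R * mu / (2 * C) * ((t%:R - 1) / 2)))).
Proof.
move=> kN; pose c t := t.+1%:R * mu / (2 * C) + k%:R * mu / (2 * C) * ((t%:R - 1) / 2).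
apply: (@mean_le_weaken _ _ _ _ _ (\sum_(i < m) (\sum_(1 <= t < (T k).+1) t%:R)^-1
  * \sum_(1 <= t < (T k).+1) t%:R * ((M ^+ 2 + sigma ^+ 2) / c t + 0))).
  rewrite sumr_const card_ord -[_ *+ m]mulr_natl mulrCA le_eqVlt; apply/orP; left.
  apply/eqP; congr (_ * _); rewrite mulr_sumr; apply: eq_bigr => t _.
  by rewrite addr0 -/(c t); ring.
apply: mean_le_sum => i _; apply: mean_leZ.
  by rewrite invr_ge0 sumr_ge0.
apply: mean_le_sum => -[|t]; rewrite mem_index_iota // ltnS => /andP[_ tT].
apply: mean_leZ => //=.
have mY : coord_measurable (fun om => row i (u om k t)).
  by apply: (coord_measurable_row _).1; apply: search_point_measurable; rewrite // ltnW.
have XY om : X i (row i (u om k t)) by apply: in_prod_u => //; exact: ltnW.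
have Gu v j (Xv : X i v) := G_unbiased j kN tT Xv.
have Gv v (Xv : X i v) := G_variance kN tT Xv.
rewrite /oracle_noise; apply: mean_leD; last first.
  exact: (noise_inner (@X_closed i) (nu_norm i) mY XY (xi_indep kN tT)
    (@G_measurable i) Gu Gv (@b_ge i)).
apply: mean_leZr; first by rewrite invr_ge0 ltW// phase_weight_gt0.
apply: mean_leD; first exact: mean_le_cst.
exact: (noise_sqr (@X_closed i) (nu_norm i) mY XY (xi_indep kN tT)
  (@G_measurable i) Gu Gv).
Qed.

End sdcs_run_measurability.

(** * Diameter of the domains, final constants and the two bounds *)

Lemma domain_bounded (R : realType) (d : nat) (X : set 'rV[R]_d)
    (nu : 'rV[R]_d -> R) (mu M : R) (f : 'rV[R]_d -> R)
    (f' : 'rV[R]_d -> 'rV[R]_d) :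
  is_norm nu -> 0 < mu ->
  (forall v z, X v -> X z ->
     mu / 2 * nu (v - z) ^+ 2 <= f v - f z - inner (f' z) (v - z)
     /\ f v - f z - inner (f' z) (v - z) <= M * nu (v - z)) ->
  forall v z, X v -> X z -> nu (z - v) <= 2 * `|M| / mu.
Proof.
(* The two bounds on the Bregman distance of [f] sandwich [mu / 2 * n ^+ 2 <= M * n] for
   [n = nu (z - v)], and [n] is divided out. *)
move=> nuP mu0 H v z Xv Xz; have [h1 h2] := H _ _ Xz Xv.
have n0 := norm_ge0 nuP (z - v).
have [->|nz] := eqVneq (nu (z - v)) 0; first by rewrite divr_ge0 ?mulr_ge0// ltW.
have np : 0 < nu (z - v) by rewrite lt_neqAle eq_sym nz.
rewrite ler_pdivlMr// -(ler_pM2r np).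
have : M * nu (z - v) <= `|M| * nu (z - v) by rewrite ler_wpM2r// ler_norm.
move: (nu (z - v)) h1 h2 => n; nra.
Qed.

Lemma outer_weights_sum (R : realType) (n : nat) :
  \sum_(1 <= k < n.+1) k.+1%:R = n%:R * (n%:R + 3) / 2 :> R.
Proof.
elim: n => [|n IH]; first by rewrite big_nil !mul0r.
by rewrite big_nat_recr//= IH -!natr1; field.
Qed.

(** The base on the right is the constant [c0] at which the square root is linearized. After
    substituting the square of [q], every remaining term of the difference is nonnegative. *)
Lemma feasibility_target_sqr (R : realType) (l mu C D V r : R) :
  0 < l -> 0 < mu -> 0 < C -> 0 <= 2 * D + V -> 0 <= r ->
  52 * (2 * l ^+ 2 * C / mu) * (mu / C * V + 2 * l ^+ 2 * C / mu * r ^+ 2 + 2 * mu * D / C)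
  <= (12 * l * Num.sqrt (2 * D + V) + 24 * l ^+ 2 * C / mu * r) ^+ 2.
Proof.
move=> l0 mu0 C0 S0 r0; set K := 2 * _ * C / mu; have := sqr_sqrtr S0.
move: (sqrtr_ge0 (2 * D + V)); set q := Num.sqrt _ => q0 qE.
rewrite -subr_ge0.
have -> : (12 * l * q + 24 * l ^+ 2 * C / mu * r) ^+ 2
    - 52 * K * (mu / C * V + K * r ^+ 2 + 2 * mu * D / C)
    = 104 * l ^+ 2 * (q ^+ 2 - (2 * D + V)) + 40 * l ^+ 2 * q ^+ 2
      + 576 * (l ^+ 3 * C / mu) * (q * r) + 368 * (l ^+ 2 * C / mu) ^+ 2 * r ^+ 2.
  by rewrite /K; field; rewrite !gt_eqF.
rewrite qE subrr mulr0 add0r.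
have l2 : 0 <= l ^+ 2 := sqr_ge0 _.
have h1 : 0 <= l ^+ 2 * (2 * D + V) by exact: mulr_ge0.
have h2 : 0 <= l ^+ 3 * C / mu * (q * r).
  apply: mulr_ge0; last exact: mulr_ge0.
  by rewrite ltW// divr_gt0// mulr_gt0// exprn_gt0.
have h3 : 0 <= (l ^+ 2 * C / mu) ^+ 2 * r ^+ 2.
  by apply: mulr_ge0; exact: sqr_ge0.
move: h1 h2 h3; lra.
Qed.

Theorem theorem6 (R : realType) (m d : nat) (hm : (2 <= m)%N) (hd : (1 <= d)%N)
  (* the graph *)
  (e : rel 'I_m) (e_sym : symmetric e) (e_conn : forall i j, connect e i j)
  (* the constraint sets, norms, costs and their subgradients *)
  (X : 'I_m -> set 'rV[R]_d)
  (X_closed : forall i, closed (X i))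
  (X_convex : forall i, convex_set (X i))
  (X_meet : exists z, forall i, X i z)
  (nu : 'I_m -> 'rV[R]_d -> R) (nu_norm : forall i, is_norm (nu i))
  (mu M : R) (mu_gt0 : 0 < mu) (M_gt0 : 0 < M)
  (f : 'I_m -> 'rV[R]_d -> R) (f' : 'I_m -> 'rV[R]_d -> 'rV[R]_d)
  (f_convex : forall i, convex_function (X i) (f i))
  (f'_subgrad : forall i v, X i v -> subdifferential (X i) (f i) v (f' i v))
  (f_bounds : forall i v z, X i v -> X i z ->
     mu / 2 * nu i (v - z) ^+ 2 <= f i v - f i z - inner (f' i z) (v - z)
     /\ f i v - f i z - inner (f' i z) (v - z) <= M * nu i (v - z))
  (* the prox-functions *)
  (w : 'I_m -> 'rV[R]_d -> R) (gw : 'I_m -> 'rV[R]_d -> 'rV[R]_d)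
  (w_C1 : forall i, C1_on (X i) (w i) (gw i))
  (w_strong : forall i v z, X i v -> X i z ->
     nu i (v - z) ^+ 2 <= inner (gw i v - gw i z) (v - z))
  (C : R) (C_gt0 : 0 < C)
  (w_growth : forall i v z, X i v -> X i z ->
     bregman (w i) (gw i) v z <= C / 2 * nu i (v - z) ^+ 2)
  (* the optimal solution and the saddle point *)
  (xs ys : 'M[R]_(m, d))
  (xs_opt : optimal_solution e X f xs)
  (xs_ys_saddle : saddle_point e X f xs ys)
  (* the parameters of the method *)
  (sigma D : R) (D_gt0 : 0 < D) (N : nat) (hN : (2 <= N)%N)
  (alpha theta eta tau lambda : nat -> R) (beta : nat -> nat -> R)
  (T : nat -> nat)
  (lambdaE : forall t, lambda t = t%:R)
  (betaE : forall k t, beta k t =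
     t.+1%:R * mu / (2 * eta k * C) + (t%:R - 1) / 2)
  (alphaE : forall k, alpha k = k%:R / k.+1%:R)
  (thetaE : forall k, theta k = k.+1%:R)
  (etaE : forall k, eta k = k%:R * mu / (2 * C))
  (tauE : forall k, tau k = 4 * bigL_norm e nu ^+ 2 * C / (k.+1%:R * mu))
  (TE : forall k, (T k)%:Z =
     let r := Num.sqrt (m%:R * (M ^+ 2 + sigma ^+ 2) / D) in
     Num.ceil (r * (2 * N%:R * C / mu) * Num.max (r * (8 * C / mu)) 1))
  (* the stochastic oracle: xi i k t is drawn in the (t+1)-st inner step of
     phase k *)
  (dOmega : measure_display) (Omega : measurableType dOmega)
  (P : probability Omega R)
  (dXi : 'I_m -> measure_display) (Xi : forall i, measurableType (dXi i))
  (xi : forall i, nat -> nat -> {RV P >-> Xi i})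
  (G : forall i, 'rV[R]_d -> Xi i -> 'rV[R]_d)
  (G_measurable : forall i,
     measurable_fun ((X i : set (borelV R d)) `*` [set: Xi i])
       (fun p : borelV R d * Xi i => G i p.1 p.2 : borelV R d))
  (G_unbiased : forall i k t v j, (1 <= k <= N)%N -> (t < T k)%N -> X i v ->
     ('E_P[fun om => (G i v (xi i k t om) 0 j)%R] = (f' i v 0 j)%:E)%E)
  (G_variance : forall i k t v, (1 <= k <= N)%N -> (t < T k)%N -> X i v ->
     ('E_P[fun om => (dual_norm (nu i) (G i v (xi i k t om) - f' i v) ^+ 2)%R]
       <= (sigma ^+ 2)%:E)%E)
  (* a run of the method *)
  (x0 y0 : 'M[R]_(m, d)) (hx0 : in_prod X x0)
  (x xh y : Omega -> nat -> 'M[R]_(m, d))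
  (u : Omega -> nat -> nat -> 'M[R]_(m, d))
  (run : forall om, sdcs_path e X w gw alpha tau eta lambda beta T N x0 y0
     (fun i k t v => G i v (xi i k t om)) (x om) (xh om) (y om) (u om))
  (xi_indep : forall i k t, (1 <= k <= N)%N -> (t < T k)%N ->
     independent P (fun om => row i (u om k t) : borelV R d) (xi i k t)) :
  let xavg om := (2 / (N%:R * (N%:R + 3))) *:
                 (\sum_(1 <= k < N.+1) theta k *: xh om k) in
  ('E_P[fun om => (total_cost f (xavg om) - total_cost f xs)%R]
     <= (2 / (N%:R * (N%:R + 3)) *
         (mu / C * bigV w gw x0 xs
          + 2 * bigL_norm e nu ^+ 2 * C / mu * enorm y0 ^+ 2
          + 2 * mu * D / C))%:E)%E
  /\ ('E_P[fun om => enorm (bigL e (xavg om))]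
     <= (8 * bigL_norm e nu / (N%:R * (N%:R + 3)) *
         (3 * Num.sqrt (2 * D + bigV w gw x0 xs)
          + 7 * bigL_norm e nu * C / mu * enorm (ys - y0)))%:E)%E.
Proof.
have {}alphaE : alpha = (fun k => k%:R / k.+1%:R) by exact/funext.
have {}thetaE : theta = (fun k => k.+1%:R) by exact/funext.
have {}lambdaE : lambda = (fun t => t%:R) by exact/funext.
have {}tauE : tau = (fun k => 4 * bigL_norm e nu ^+ 2 * C / (k.+1%:R * mu)).
  exact/funext.
subst alpha theta lambda tau.
pose l := bigL_norm e nu; pose A := m%:R * (M ^+ 2 + sigma ^+ 2).
have A_gt0 : 0 < A.
  by rewrite mulr_gt0 ?ltr0n ?(ltnW hm)// ltr_wpDr ?sqr_ge0// exprn_gt0.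
have l_gt0 : 0 < l := bigL_norm_gt0 nu_norm hm hd e_conn.
have T_gt0 k : (0 < T k)%N.
  by have [] := inner_steps_ge mu_gt0 C_gt0 D_gt0 A_gt0 hN (TE k).
(* The step count is the same in all phases, so a single error budget covers them. *)
have T_cst k : T k = T 0%N by apply/eqP; rewrite -eqz_nat !TE.
have [Xs Lxs] : in_prod X xs /\ bigL e xs = 0 by case: xs_opt.
pose V0 := bigV w gw x0 xs; pose K := 2 * l ^+ 2 * C / mu.
pose E om k := phase_error nu mu M C f' T
  (fun i k t v => G i v (xi i k t om)) (u om) xs k.
pose W om := \sum_(1 <= k < N.+1) k.+1%:R * E om k.
have W_mean : mean_le P W (2 * mu * D / C).
  apply: mean_le_weaken (total_error_le mu_gt0 C_gt0 D_gt0 A_gt0 hN (TE 0%N)) _.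
  apply: mean_le_sum => k; rewrite mem_index_iota ltnS => kN.
  apply: mean_leZ => //; rewrite -(T_cst k).
  apply: (phase_error_mean X_closed X_convex nu_norm mu_gt0 C_gt0 w_C1 w_strong
    hx0 T_gt0 etaE betaE G_measurable run M G_unbiased G_variance xi_indep
    (b := fun=> 2 * `|M| / mu)) => // i v Xv.
  exact: (domain_bounded (nu_norm i) mu_gt0 (@f_bounds i) Xv (Xs i)).
have x00 om : x om 0%N = x0 by have [] := sdcs_init (run om).
have xh00 om : xh om 0%N = x om 0%N by have [-> ->] := sdcs_init (run om).
have y00 om : y om 0%N = y0 by have [] := sdcs_init (run om).
have Xx om k (kN : (k <= N)%N) : in_prod X (x om k) := in_prod_primal hx0 T_gt0 (run om) kN.
have Xxh om k (kN : (1 <= k <= N)%N) : in_prod X (xh om k) :=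
  in_prod_average X_convex T_gt0 (run om) kN.
have V_ge om k : (1 <= k <= N)%N ->
    primal_norm nu (xh om k - x om k.-1) ^+ 2 / 2 <= bigV w gw (x om k.-1) (xh om k).
  move=> kN; rewrite sqr_primal_norm mulr_suml; apply: ler_sum => i _.
  rewrite linearB /=.
  apply: (bregman_ge (@X_convex i) (w_C1 i) (nu_norm i) (@w_strong i)).
    by apply: Xx; case/andP: kN => _; apply: leq_trans; exact: leq_pred.
  exact: Xxh.
have V_ge0 om k : (0 <= k <= N)%N -> 0 <= bigV w gw (x om k) xs.
  move=> kN; apply: sumr_ge0 => i _.
  by apply: (bregman_ge0 (@X_convex i) (w_C1 i) (nu_norm i) (@w_strong i)) => //; exact: Xx.
have phase om k : (1 <= k <= N)%N ->
    total_cost f (xh om k) - total_cost f xs + inner (bigL e (y om k)) (xh om k - xs)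
    + k%:R * mu / (2 * C) * (bigV w gw (x om k.-1) (xh om k) - bigV w gw (x om k.-1) xs)
    + (k%:R * mu / (2 * C) + mu / C) * bigV w gw (x om k) xs <= E om k.
  move=> kN; rewrite -etaE.
  exact: (phase_inequality X_convex nu_norm mu_gt0 C_gt0 f_bounds w_C1 w_strong
    w_growth hx0 T_gt0 etaE betaE (run om) Xs kN).
have N_gt0 : 0 < N%:R :> R by rewrite ltr0n ltnW.
pose Aw : R := N%:R * (N%:R + 3) / 2.
have Aw_gt0 : 0 < Aw by rewrite divr_gt0// mulr_gt0// ltr_wpDl.
have AwV : 2 / (N%:R * (N%:R + 3)) = Aw^-1 by rewrite /Aw invf_div.
have AwE : \sum_(1 <= k < N.+1) k.+1%:R = Aw by exact: outer_weights_sum.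
have D0 : 0 < mu * D / C by rewrite divr_gt0// mulr_gt0.
move=> xavg; split.
  apply: (@le_trans _ _ ('E_P[fun om =>
    (Aw^-1 * (mu / C * V0 + K * enorm y0 ^+ 2 + W om))%R])%E).
    apply: expectation_mono => om.
    have := outer_primal_gap e_sym nu_norm l_gt0 mu_gt0 C_gt0 (@V_ge om) (@V_ge0 om)
      Lxs (xh00 om) (sdcs_dual (run om)) (@phase om).
    rewrite x00 y00 => h; rewrite ler_pdivlMl//; apply: le_trans h.
    under eq_bigr do rewrite mulrBr.
    rewrite mulrBr sumrB -mulr_suml AwE lerD2r /total_cost mulr_sumr.
    under [leRHS]eq_bigr do rewrite mulr_sumr.
    rewrite [leRHS]exchange_big /=; apply: ler_sum => i _.
    have xavgE : row i (xavg om) = (\sum_(1 <= k < N.+1) k.+1%:R)^-1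
        *: \sum_(1 <= k < N.+1) k.+1%:R *: row i (xh om k).
      rewrite /xavg AwV AwE linearZ linear_sum; congr (_ *: _).
      by apply: eq_bigr => k _; rewrite linearZ.
    have Xavg : X i (row i (xavg om)).
      rewrite xavgE; apply: convex_comb => //; first exact: ltnW.
      by move=> k kN; split; [rewrite ltr0n|exact: Xxh].
    (* Jensen for each agent, with the affine minorant given by the subgradient at the averaged
       point. *)
    rewrite -AwE; apply: (jensen_affine_minorant (g := f' i (row i (xavg om)))) xavgE _.
      by rewrite AwE.
    by move=> k kN; split => //; apply: f'_subgrad => //; exact: Xxh.
  have := mean_leZ (_ : 0 <= Aw^-1) (mean_leD (mean_le_cst P (mu / C * V0 + K * enorm y0 ^+ 2)) W_mean).
  by rewrite invr_ge0 (ltW Aw_gt0) AwV => /(_ isT)[_].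
pose r := enorm (ys - y0); pose S := 2 * D + V0.
(* [V_ge0] speaks of a run, so a sample point is picked; the space is nonempty because it has
   probability 1. *)
have V00 : 0 <= V0.
  have [om _] : [set: Omega] !=set0.
    apply/set0P; apply: contraT => /negPn/eqP O0.
    by have := probability_setT P; rewrite O0 measure0 => /eqP; rewrite eqe eq_sym oner_eq0.
  by rewrite /V0 -(x00 om); exact: V_ge0.
have r0 : 0 <= r := enorm_ge0 _.
have S0 : 0 < S by rewrite ltr_pwDl// mulr_gt0.
(* The target is [Aw^-1 * (2 * K * r + c0)]: here [12 = 4 * 3] and [24 = 4 * 7 - 4], where the 4
   taken off is the coefficient in [2 * K * r]. *)
pose c0 := 12 * l * Num.sqrt S + 24 * l ^+ 2 * C / mu * r.
have c00 : 0 < c0.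
  apply: ltr_pwDl; first by rewrite !mulr_gt0 ?sqrtr_gt0.
  by rewrite mulr_ge0// divr_ge0 ?mulr_ge0 ?sqr_ge0// ltW.
have K_gt0 : 0 < K by rewrite divr_gt0 ?mulr_gt0 ?exprn_gt0.
pose B := mu / C * V0 + K * r ^+ 2.
have B_le : 52 * K * (B + 2 * mu * D / C) <= c0 ^+ 2.
  exact: (feasibility_target_sqr l_gt0 mu_gt0 C_gt0 (ltW S0) r0).
apply: (@le_trans _ _ ('E_P[fun om =>
    (Aw^-1 * (2 * K * r + ((52 * K / c0) * (B + W om) + c0) / 2))%R])%E).
  apply: expectation_mono => om.
  (* The saddle inequality in the primal variable, where the constraint term at [xs] vanishes by
     [Lxs]. *)
  have sad k : (1 <= k <= N)%N -> 0 <= total_cost f (xh om k) - total_cost f xs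
      + inner (bigL e (xh om k)) ys.
    move=> kN; have [_ H] := xs_ys_saddle.
    have [_] := H _ ys (Xxh om k kN); rewrite Lxs inner0l addr0; lra.
  have := outer_feasibility e_sym nu_norm l_gt0 mu_gt0 C_gt0 (@V_ge om) (@V_ge0 om)
    Lxs (xh00 om) (sdcs_dual (run om)) (@phase om) hN sad c00.
  rewrite x00 y00 -/l -/K -/r -/V0 -/B -/(W om).
  rewrite /xavg bigLZ bigL_sum enormZ AwV ger0_norm ?invr_ge0 ?(ltW Aw_gt0)// => h.
  rewrite ler_pM2l ?invr_gt0//; under eq_bigr do rewrite bigLZ.
  by apply: le_trans h _; rewrite le_eqVlt; apply/orP; left; apply/eqP; ring.
have k0 : 0 <= 52 * K / c0.
  by apply: divr_ge0 (ltW c00); apply: mulr_ge0 (ltW K_gt0); rewrite ler0n.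
have Aw0 : 0 <= Aw^-1 by rewrite invr_ge0 ltW.
have half : 0 <= 2^-1 :> R by rewrite invr_ge0.
have [_] := mean_leZ Aw0 (mean_leD (mean_le_cst P (2 * K * r))
  (mean_leZr half (mean_leD (mean_leZ k0 (mean_leD (mean_le_cst P B) W_mean))
    (mean_le_cst P c0)))).
move=> h; apply: le_trans h _; rewrite lee_fin.
have -> : 8 * bigL_norm e nu / (N%:R * (N%:R + 3)) *
    (3 * Num.sqrt (2 * D + bigV w gw x0 xs)
     + 7 * bigL_norm e nu * C / mu * enorm (ys - y0)) = Aw^-1 * (2 * K * r + c0).
  by rewrite -/l -/V0 -/S -/r /Aw /K /c0; field; rewrite !gt_eqF// ltr_wpDl.
rewrite ler_wpM2l// lerD2l ler_pdivrMr//.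
(* By [B_le], both halves of the linearized square root are at most [c0 / 2]. *)
have : 52 * K / c0 * (B + 2 * mu * D / C) <= c0.
  by rewrite mulrAC ler_pdivrMr// -expr2.
lra.
Qed.
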